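(* For any arbitrarily large constant $c > 0$ and any arbitrarily small constant $\epsilon > 0$, there is no algorithm for fully dynamic subset sum with amortized processing time $O(\mathsf{t}_{\mathsf{max}}^{1-\epsilon})$ when the number of operations is $\Omega(\mathsf{t}_{\mathsf{max}}^c)$, unless the Strong Exponential Time Hypothesis (SETH) fails.
   Context: Fully dynamic subset sum: an integer upper bound $\mathsf{t}_{\mathsf{max}}$ is given in advance and a multiset of items with non-negative integer weights is initially empty. Each operation is one of: (1) insertion of an item of a given non-negative integer weight; (2) deletion of an item currently present; (3) a query giving an integer $0 \le t \le \mathsf{t}_{\mathsf{max}}$ and asking whether some sub-multiset of the current items has weights summing to exactly $t$. The amortized processing time is the total running time over all operations divided by the number of operations. SETH: for every constant $\delta > 0$ there is a constant $k \ge 3$ such that $k$-SAT on $m$ variables cannot be solved in time $O(2^{(1-\delta)m})$. *)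

(* Defs.v *)
From Stdlib Require Import Reals Arith List Permutation.
Import ListNotations.

(** * Machine model

    A deterministic word RAM, programmed by structured commands.  The memory
    consists of arrays of words indexed by words; a program mentions only
    finitely many arrays, so up to a constant factor in time this is a single
    random-access memory (interleave the arrays), and the scalar variables are
    cells with constant index.  Words are the naturals below a capacity [B]; an
    execution producing a value that is not below [B] is stuck. *)

Inductive binop : Set :=
| Add | Sub | Mul | Div | Mod | And | Or | Xor | Shl | Shr | Eq | Lt.

Inductive expr : Set :=
| Const (n : nat)
| Cell (a : nat) (i : expr)
| Bin (o : binop) (x y : expr).

Inductive cmd : Set :=
| Skip
| Assign (a : nat) (i x : expr)
| Seq (p q : cmd)
| If (x : expr) (p q : cmd)
| While (x : expr) (p : cmd).

Definition memory : Type := nat -> nat -> nat.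

Definition write (s : memory) (a i x : nat) : memory :=
  fun a' i' => if ((a' =? a) && (i' =? i))%bool then x else s a' i'.

Definition eval_binop (o : binop) (x y : nat) : nat :=
  match o with
  | Add => x + y
  | Sub => x - y
  | Mul => x * y
  | Div => x / y
  | Mod => x mod y
  | And => Nat.land x y
  | Or => Nat.lor x y
  | Xor => Nat.lxor x y
  | Shl => Nat.shiftl x y
  | Shr => Nat.shiftr x y
  | Eq => Nat.b2n (x =? y)
  | Lt => Nat.b2n (x <? y)
  end.

Definition word (B x : nat) : option nat := if x <? B then Some x else None.

Fixpoint eval (B : nat) (s : memory) (e : expr) : option nat :=
  match e with
  | Const n => word B n
  | Cell a i =>
      match eval B s i with
      | Some j => word B (s a j)
      | None => None
      end
  | Bin o x y =>
      match eval B s x, eval B s y with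
      | Some u, Some v => word B (eval_binop o u v)
      | _, _ => None
      end
  end.

Fixpoint cost (e : expr) : nat :=
  match e with
  | Const _ => 1
  | Cell _ i => S (cost i)
  | Bin _ x y => S (cost x + cost y)
  end.

(** [exec B p s T s']: started in [s], the program [p] halts in [s'] after [T]
    unit-time steps without exceeding the capacity [B]. *)
Inductive exec (B : nat) : cmd -> memory -> nat -> memory -> Prop :=
| exec_Skip s : exec B Skip s 1 s
| exec_Assign a i x s j v :
    eval B s i = Some j -> eval B s x = Some v ->
    exec B (Assign a i x) s (S (cost i + cost x)) (write s a j v)
| exec_Seq p q s s' s'' T T' :
    exec B p s T s' -> exec B q s' T' s'' ->
    exec B (Seq p q) s (S (T + T')) s''
| exec_If_true x p q s s' v T :
    eval B s x = Some v -> v <> 0 -> exec B p s T s' ->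
    exec B (If x p q) s (S (cost x + T)) s'
| exec_If_false x p q s s' T :
    eval B s x = Some 0 -> exec B q s T s' ->
    exec B (If x p q) s (S (cost x + T)) s'
| exec_While_true x p s s' s'' v T T' :
    eval B s x = Some v -> v <> 0 ->
    exec B p s T s' -> exec B (While x p) s' T' s'' ->
    exec B (While x p) s (S (cost x + T + T')) s''
| exec_While_false x p s :
    eval B s x = Some 0 ->
    exec B (While x p) s (S (cost x)) s.

(** Inputs are placed in array 0, all other cells being 0; a yes/no output is
    read off the first cell of array 1. *)
Definition input_memory (l : list nat) : memory :=
  fun a i => if a =? 0 then nth i l 0 else 0.

Definition accepts (s : memory) : Prop := s 1 0 <> 0.

(** * k-SAT and the Strong Exponential Time Hypothesis *)

(** A literal is a variable together with its sign ([true]: positive). *)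
Definition literal : Set := (nat * bool)%type.
Definition clause : Set := list literal.
Definition cnf : Set := list clause.

(** Clauses are not repeated, so a [k]-CNF formula on [m] variables has size
    polynomial in [m], and running times can be stated in terms of [m] alone. *)
Definition is_kcnf (k m : nat) (phi : cnf) : Prop :=
  NoDup phi /\
  forall C, In C phi ->
    length C <= k /\ forall l, In l C -> fst l < m.

Definition satisfiable (phi : cnf) : Prop :=
  exists sigma : nat -> bool,
    forall C, In C phi -> exists l, In l C /\ sigma (fst l) = snd l.

Definition encode_literal (l : literal) : nat := 2 * fst l + Nat.b2n (snd l).

Definition encode_cnf (m : nat) (phi : cnf) : list nat :=
  m :: length phi ::
  flat_map (fun C => length C :: map encode_literal C) phi.

(** Words have [O(m)] bits, so that memory of size exponential in [m] can be
    addressed. *)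
Definition ksat_solvable (k : nat) (delta : R) : Prop :=
  exists (p : cmd) (b : nat) (K : R),
    forall (m : nat) (phi : cnf), is_kcnf k m phi ->
      exists (T : nat) (s : memory),
        exec (2 ^ (b * S m)) p (input_memory (encode_cnf m phi)) T s /\
        (accepts s <-> satisfiable phi) /\
        (INR T <= K * Rpower 2 ((1 - delta) * INR m))%R.

Definition SETH : Prop :=
  forall delta : R, (0 < delta)%R ->
    exists k : nat, 3 <= k /\ ~ ksat_solvable k delta.

(** * Fully dynamic subset sum *)

Inductive operation : Set :=
| Insert (x : nat)
| Delete (x : nat)
| Query (t : nat).

(** The multiset of the weights of the current items is a list, considered up
    to permutation; a deletion specifies the weight of the item to delete. *)
Fixpoint remove_one (x : nat) (M : list nat) : list nat :=
  match M with
  | [] => []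
  | y :: M' => if x =? y then M' else y :: remove_one x M'
  end.

Definition update (o : operation) (M : list nat) : list nat :=
  match o with
  | Insert x => x :: M
  | Delete x => remove_one x M
  | Query _ => M
  end.

Definition allowed (tmax : nat) (M : list nat) (o : operation) : Prop :=
  match o with
  | Insert _ => True
  | Delete x => In x M
  | Query t => t <= tmax
  end.

Fixpoint valid (tmax : nat) (M : list nat) (ops : list operation) : Prop :=
  match ops with
  | [] => True
  | o :: ops' => allowed tmax M o /\ valid tmax (update o M) ops'
  end.

Definition subset_sum (M : list nat) (t : nat) : Prop :=
  exists sub rest : list nat,
    Permutation (sub ++ rest) M /\ list_sum sub = t.

Definition opcode (o : operation) : nat :=
  match o with Insert _ => 0 | Delete _ => 1 | Query _ => 2 end.

Definition operand (o : operation) : nat :=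
  match o with Insert x => x | Delete x => x | Query t => t end.

Definition receive (o : operation) (s : memory) : memory :=
  write (write s 0 0 (opcode o)) 0 1 (operand o).

Definition answers (o : operation) (M : list nat) (s : memory) : Prop :=
  match o with
  | Query t => accepts s <-> subset_sum M t
  | _ => True
  end.

(** [serves B p M s ops T]: with current items [M] and memory [s], running [p]
    once for each operation, the memory persisting between the runs and each
    query being answered before the next operation is revealed, processes [ops]
    correctly in total time [T]. *)
Inductive serves (B : nat) (p : cmd) :
  list nat -> memory -> list operation -> nat -> Prop :=
| serves_nil M s : serves B p M s [] 0
| serves_cons M s o ops s' T T' :
    exec B p (receive o s) T s' ->
    answers o M s' ->
    serves B p (update o M) s' ops T' ->
    serves B p M s (o :: ops) (T + T').

(** Number of bits sufficient for [tmax], the number of operations, and every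
    number occurring in them. *)
Definition word_length (tmax : nat) (ops : list operation) : nat :=
  S (Nat.log2 (list_max (tmax :: length ops :: map operand ops))).

(** Words have [b * word_length tmax ops] bits.  As usual on the word RAM, the
    program has access to the word length; [tmax] and the word length are
    available from the start, and any initialization based on them is part of
    the (timed) first operation. *)
Definition processes (b : nat) (p : cmd)
    (tmax : nat) (ops : list operation) (T : nat) : Prop :=
  serves (2 ^ (b * word_length tmax ops)) p []
    (input_memory [0; 0; tmax; word_length tmax ops]) ops T.

Definition solves_dynamic_subset_sum (b : nat) (p : cmd) : Prop :=
  forall (tmax : nat) (ops : list operation),
    valid tmax [] ops -> exists T : nat, processes b p tmax ops T.

(** Amortized processing time [O(tmax ^ (1 - eps))] on operation sequences of
    length at least [a * tmax ^ c], for some constant [a > 0]. *)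
Definition amortized_time_bound (b : nat) (p : cmd) (c eps : R) : Prop :=
  exists (a K : R) (t0 : nat), (0 < a)%R /\ 0 < t0 /\
    forall (tmax : nat) (ops : list operation) (T : nat),
      t0 <= tmax ->
      valid tmax [] ops ->
      (a * Rpower (INR tmax) c <= INR (length ops))%R ->
      processes b p tmax ops T ->
      (INR T / INR (length ops) <= K * Rpower (INR tmax) (1 - eps))%R.

(* Main.v *)
Require Import Defs.
From Stdlib Require Import Reals.
From Stdlib Require Import Arith List Permutation Lia Bool Lra ZArith.
(* Again, since [List] shadows the constructor [Add]. *)
Require Import Defs.
Import ListNotations.

(** The [m] variables of a [k]-CNF are split into [q] blocks of [a] variables,
    where [a = m / D] and [q], [D] are constants, and a prefix, all of whose
    assignments [P] are tried one after the other by inserting items, querying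
    one fixed target and deleting the items again.  As a constant number of
    blocks is used, exponentially many items are affordable, so neither
    sparsification nor average-free sets are needed: for each [k]-tuple of blocks
    there is one item for every assignment of these blocks that, together with
    [P], falsifies no clause.  An item adds the assignment of each of its blocks,
    read as a number below [A = 2 ^ a], to the digit of that block, and its square
    to a digit common to all blocks; high digits force one item per tuple to be
    chosen.  If [d] slots belong to each block, a further item per block adds
    [d (A - beta)] and [d (A ^ 2 - beta ^ 2)].  The target thus prescribes that,
    for each block, the values in its slots sum to [d beta] and that all squares
    sum to the sum of [d beta ^ 2] over the blocks; hence the squared deviations
    from [beta] sum to [0], and all chosen items agree.  The target is
    [2 ^ ((q + 2) a + O(1))], an amortized time of its power [1 - eps] saves a
    factor [2 ^ (eps q a / 2)] over [2 ^ m], and [q a] is a fraction of [m]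
    depending on [c] only. *)

(** * Sums and digits *)

(** The order of choices is the crux. SETH returns [k] only after the saving [delta] is fixed, while
    [q] must grow with [k]: an item index has [k] slots of [a] bits and the square digit takes [2 a]
    bits, an overhead of [(k + 2) a] bits that half of the saving [eps q a] has to pay for. So
    [delta] may involve neither [k] nor [q]; with an integer [C >= c] and [D = 3 C q], the part
    [q a] is about [m / (3 C)]. It cannot be much larger, because the prefixes have to supply
    [tmax ^ C] operations, which needs [q a + C (q + 2) a <= m].

    Sums alone would fix only the mean of the slots of a block; with the sum of squares the variance
    is fixed to zero. One square digit serves all blocks, as squared deviations cannot cancel.

    The time bound in [ksat_solvable] has no polynomial factor, yet every item is tested against all
    clauses. Their number is polynomial in [m = O(a)], so each test is charged to a factor
    [2 ^ a]. *)

Fixpoint sum (n : nat) (f : nat -> nat) : nat :=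
  match n with 0 => 0 | S n' => sum n' f + f n' end.

Lemma sum_ext n f g : (forall i, i < n -> f i = g i) -> sum n f = sum n g.
Proof. induction n; simpl; intros H; [easy|]. rewrite IHn, H; auto. Qed.

Lemma sum_add n f g : sum n (fun i => f i + g i) = sum n f + sum n g.
Proof. induction n; simpl; lia. Qed.

Lemma sum_mul_l n c f : sum n (fun i => c * f i) = c * sum n f.
Proof. induction n; simpl; lia. Qed.

Lemma sum_mul_r n c f : sum n (fun i => f i * c) = sum n f * c.
Proof. induction n; simpl; lia. Qed.

Lemma sum_const n c : sum n (fun _ => c) = n * c.
Proof. induction n; simpl; lia. Qed.

Lemma sum_le n f g : (forall i, i < n -> f i <= g i) -> sum n f <= sum n g.
Proof.
  induction n; simpl; intros H; [easy|].
  assert (sum n f <= sum n g) by auto. specialize (H n ltac:(lia)). lia.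
Qed.

Lemma sum_swap n m f :
  sum n (fun i => sum m (fun j => f i j)) = sum m (fun j => sum n (fun i => f i j)).
Proof.
  induction n; simpl.
  - rewrite sum_const. lia.
  - rewrite IHn. symmetry. apply sum_add.
Qed.

Lemma sum_split n m f : sum (n + m) f = sum n f + sum m (fun i => f (n + i)).
Proof.
  induction m; simpl; [now rewrite Nat.add_0_r|].
  rewrite Nat.add_succ_r. simpl. lia.
Qed.

Lemma sum_rectangle n m f :
  sum (n * m) f = sum n (fun i => sum m (fun j => f (i * m + j))).
Proof.
  induction n; simpl; [easy|].
  rewrite Nat.add_comm, sum_split, IHn. lia.
Qed.

Lemma sum_indicator n b c :
  b < n -> sum n (fun i => if i =? b then c i else 0) = c b.
Proof.
  induction n; simpl; intros H; [lia|].
  destruct (Nat.eqb_spec n b) as [->|E].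
  - rewrite (sum_ext _ _ (fun _ => 0)), sum_const; [lia|].
    intros i Hi. destruct (Nat.eqb_spec i b); lia.
  - rewrite IHn; lia.
Qed.

Lemma sum_term_le n f i : i < n -> f i <= sum n f.
Proof.
  induction n; simpl; intros H; [lia|].
  destruct (Nat.eq_dec i n) as [->|]; [lia|]. specialize (IHn ltac:(lia)). lia.
Qed.

(** A strict inequality in one term could not be made up by the others. Applied to
    [2 x y <= x ^ 2 + y ^ 2], it extracts [x = y] in every slot. *)
Lemma sum_eq_termwise n f g :
  (forall i, i < n -> f i <= g i) -> sum n f = sum n g ->
  forall i, i < n -> f i = g i.
Proof.
  induction n; simpl; intros Hle E i Hi; [lia|].
  assert (sum n f <= sum n g) by (apply sum_le; auto).
  assert (f n <= g n) by auto.
  destruct (Nat.eq_dec i n) as [->|]; [lia|].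
  apply IHn; auto; lia.
Qed.

Lemma sum_pow_lt B n : 2 <= B -> sum n (fun i => B ^ i) < B ^ n.
Proof. induction n; simpl; intros H; [lia|]. specialize (IHn H). nia. Qed.

Lemma list_sum_map_seq n f : list_sum (map f (seq 0 n)) = sum n f.
Proof.
  induction n; simpl; [easy|].
  change (list_sum (map f (seq 0 (S n))) = sum n f + f n).
  rewrite seq_S, map_app, list_sum_app, IHn. simpl. lia.
Qed.

Lemma list_sum_permutation l l' : Permutation l l' -> list_sum l = list_sum l'.
Proof. induction 1; simpl; lia. Qed.

Lemma list_sum_map_le {X} (f : X -> nat) c l :
  (forall x, In x l -> f x <= c) -> list_sum (map f l) <= length l * c.
Proof.
  induction l; simpl; intros H; [lia|].
  assert (f a <= c) by auto. specialize (IHl ltac:(auto)). lia.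
Qed.

(** Regrouping by value turns the sum of the selection digits into a number in base [2 ^ gam] whose
    digits are the multiplicities of the groups. *)
Lemma list_sum_by_count n (h : nat -> nat) l :
  (forall x, In x l -> x < n) ->
  list_sum (map h l) = sum n (fun g => count_occ Nat.eq_dec l g * h g).
Proof.
  induction l as [|x l IH]; intros H.
  - simpl. now rewrite sum_const, Nat.mul_0_r.
  - cbn [map list_sum fold_right]. change (fold_right Nat.add 0) with list_sum.
    rewrite IH by (intros; apply H; now right).
    rewrite <- (sum_indicator n x h) by (apply H; now left).
    rewrite <- sum_add. apply sum_ext. intros i Hi. simpl.
    destruct (Nat.eq_dec x i), (Nat.eqb_spec i x); subst; try lia; easy.
Qed.

(** The parts [X] and [Y] above the [n] digits are unbounded, so a weight can be peeled layer by
    layer: block digits, square digit, selection digits. *)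
Lemma digits_unique R n : forall x y X Y,
  (forall b, b < n -> x b < R) -> (forall b, b < n -> y b < R) ->
  sum n (fun b => x b * R ^ b) + R ^ n * X = sum n (fun b => y b * R ^ b) + R ^ n * Y ->
  (forall b, b < n -> x b = y b) /\ X = Y.
Proof.
  induction n; simpl; intros x y X Y Hx Hy E.
  - split; lia.
  - assert (Hxn : x n < R) by auto. assert (Hyn : y n < R) by auto.
    (* Digit [n] is pushed into the upper part, from which division by [R] then separates it. *)
    destruct (IHn x y (x n + R * X) (y n + R * Y)) as [H1 H2]; auto; [nia|].
    assert (HX : X = Y /\ x n = y n).
    { pose proof (Nat.div_unique (x n + R * X) R X (x n) Hxn ltac:(ring)) as E1.
      pose proof (Nat.div_unique (y n + R * Y) R Y (y n) Hyn ltac:(ring)) as E2.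
      rewrite H2, <- E2 in E1. subst. lia. }
    destruct HX as [HX1 HX2]. split; [|easy].
    intros b Hb. destruct (Nat.eq_dec b n) as [->|]; auto. apply H1; lia.
Qed.

Lemma permutation_of_graph n (its : list (nat * nat)) :
  Permutation (map fst its) (seq 0 n) ->
  exists f, Permutation its (map (fun g => (g, f g)) (seq 0 n)).
Proof.
  intros H. apply Permutation_sym, Permutation_map_inv in H.
  destruct H as (its' & E & P).
  exists (fun g => snd (nth g its' (0, 0))).
  rewrite P. replace (map _ _) with its'; [easy|].
  assert (L : length its' = n).
  { rewrite <- (length_seq n 0), E, length_map. easy. }
  (* The second default is the image of [0] under the map, so that [map_nth] applies. *)
  apply (nth_ext _ _ (0,0) ((fun g => (g, snd (nth g its' (0, 0)))) 0)).
  - now rewrite length_map, length_seq.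
  - intros i Hi.
    rewrite (map_nth (fun g => (g, snd (nth g its' (0, 0))))), seq_nth by lia.
    simpl. rewrite (surjective_pairing (nth i its' (0, 0))) at 1. f_equal.
    rewrite <- (map_nth fst its' (0, 0) i), <- E, seq_nth by lia. easy.
Qed.

(** Digit [l] in base [q] takes every value equally often, [q ^ (n - 1)] times, as [g] runs below
    [q ^ n]. *)
Lemma sum_blocks q n l F :
  l < n ->
  sum (q ^ n) (fun g => F ((g / q ^ l) mod q)) = q ^ (n - 1) * sum q F.
Proof.
  intros Hl. destruct (Nat.eq_dec q 0) as [->|Hq].
  { rewrite Nat.pow_0_l by lia. simpl. lia. }
  assert (Hp : q ^ l <> 0) by (apply Nat.pow_nonzero; lia).
  replace (q ^ n) with (q ^ (n - 1 - l) * (q * q ^ l)).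
  2:{ rewrite Nat.mul_comm, <- Nat.mul_assoc, <- Nat.pow_add_r, <- Nat.pow_succ_r'.
      f_equal. lia. }
  rewrite sum_rectangle.
  rewrite (sum_ext _ _ (fun _ => q ^ l * sum q F)).
  - rewrite sum_const, Nat.mul_assoc, <- Nat.pow_add_r. do 2 f_equal. lia.
  - intros i _. rewrite sum_rectangle.
    rewrite <- sum_mul_l. apply sum_ext. intros r Hr.
    rewrite (sum_ext _ _ (fun _ => F r)).
    + now rewrite sum_const.
    + intros s Hs. f_equal.
      replace (i * (q * q ^ l) + (r * q ^ l + s)) with ((i * q + r) * q ^ l + s) by nia.
      rewrite Nat.div_add_l, (Nat.div_small s) by easy.
      rewrite Nat.add_0_r, Nat.add_comm, Nat.Div0.mod_add.
      now apply Nat.mod_small.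
Qed.

(** * The subset sum instance *)

Section Items.

Variables k q a r0 gam : nat.

(* Groups [g < q ^ k] are the tuples of blocks [blk g 0, .., blk g (k - 1)] and
   group [q ^ k + b] is the complement group of block [b]; exactly one item is to
   be chosen per group.  The number [al] packs [k] slots of [a] bits; complement
   items only use slot 0. *)
Definition degree := k * q ^ (k - 1).
Definition groups := q ^ k + q.
(** [a] bits hold a slot value; the further [r0] bits absorb the factor [degree] and the summation
    over all groups. *)
Definition digit_bits := a + r0.
Definition select_shift := q * digit_bits + (2 * a + r0).
Definition blk (g l : nat) := (g / q ^ l) mod q.
Definition slot (al l : nat) := (al / 2 ^ (a * l)) mod 2 ^ a.

Definition low (g al : nat) : nat :=
  if g <? q ^ k then
    sum k (fun l => slot al l * 2 ^ (digit_bits * blk g l)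
                    + slot al l * slot al l * 2 ^ (digit_bits * q))
  else degree * (2 ^ a - slot al 0) * 2 ^ (digit_bits * blk g 0)
       + degree * (2 ^ a * 2 ^ a - slot al 0 * slot al 0) * 2 ^ (digit_bits * q).

(** From low to high: [q] block digits, the square digit, a selection digit of [gam] bits per group,
    and a counter of the chosen items. The counter bounds the number of items before anything else
    is known about them, which excludes carries in the lower digits. *)
Definition weight (g al : nat) : nat :=
  low g al + (2 ^ (gam * groups) + 2 ^ (gam * g)) * 2 ^ select_shift.

(** No block value occurs: [degree] slots of value [beta] and the complement
    [degree * (2 ^ a - beta)] add up to [degree * 2 ^ a], and likewise for squares. *)
Definition goal : nat :=
  sum q (fun b => degree * 2 ^ a * 2 ^ (digit_bits * b))
  + q * degree * (2 ^ a * 2 ^ a) * 2 ^ (digit_bits * q)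
  + (groups * 2 ^ (gam * groups) + sum groups (fun g => 2 ^ (gam * g)))
    * 2 ^ select_shift.

Definition digit (g al b : nat) : nat :=
  if g <? q ^ k then sum k (fun l => if b =? blk g l then slot al l else 0)
  else if b =? blk g 0 then degree * (2 ^ a - slot al 0) else 0.

Definition square_digit (g al : nat) : nat :=
  if g <? q ^ k then sum k (fun l => slot al l * slot al l)
  else degree * (2 ^ a * 2 ^ a - slot al 0 * slot al 0).

Hypothesis hk : 1 <= k.
Hypothesis hq : 1 <= q.
Hypothesis hgam : groups < 2 ^ gam.
Hypothesis hr0 : groups * degree < 2 ^ r0.

Lemma blk_lt g l : blk g l < q.
Proof. clear - hq. apply Nat.mod_upper_bound. lia. Qed.

Lemma slot_lt al l : slot al l < 2 ^ a.
Proof. now apply Nat.mod_upper_bound, Nat.pow_nonzero. Qed.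

(** [q] divides [q ^ k] because [k >= 1], so [blk g 0] also names the block of a complement
    group. *)
Lemma blk_complement b : b < q -> blk (q ^ k + b) 0 = b.
Proof.
  intros Hb. unfold blk. rewrite Nat.pow_0_r, Nat.div_1_r.
  replace k with (S (k - 1)) by lia.
  rewrite Nat.pow_succ_r', Nat.mul_comm, Nat.add_comm, Nat.Div0.mod_add.
  now apply Nat.mod_small.
Qed.

(** Each of the [k] positions shows every block in [q ^ (k - 1)] tuples, so every block fills
    [degree] slots. *)
Lemma sum_over_slots F :
  sum (q ^ k) (fun g => sum k (fun l => F (blk g l))) = degree * sum q F.
Proof.
  rewrite sum_swap. unfold degree.
  rewrite (sum_ext _ _ (fun _ => q ^ (k - 1) * sum q F)).
  - rewrite sum_const. lia.
  - intros l Hl. now apply sum_blocks.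
Qed.

Lemma pow_digit b : 2 ^ (digit_bits * b) = (2 ^ digit_bits) ^ b.
Proof. apply Nat.pow_mul_r. Qed.

Lemma sum_one_digit b0 x : b0 < q ->
  sum q (fun b => (if b =? b0 then x else 0) * (2 ^ digit_bits) ^ b)
  = x * (2 ^ digit_bits) ^ b0.
Proof.
  intros H. rewrite <- (sum_indicator q b0 (fun b => x * (2 ^ digit_bits) ^ b)) by easy.
  apply sum_ext. intros b _. now destruct (b =? b0).
Qed.

Lemma low_digits g al :
  low g al = sum q (fun b => digit g al b * (2 ^ digit_bits) ^ b)
             + (2 ^ digit_bits) ^ q * square_digit g al.
Proof.
  unfold low, digit, square_digit. destruct (g <? q ^ k).
  - rewrite sum_add. rewrite sum_mul_r, pow_digit.
    rewrite (Nat.mul_comm (sum k _)). f_equal.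
    rewrite (sum_ext q _ (fun b => sum k (fun l =>
      (if b =? blk g l then slot al l else 0) * (2 ^ digit_bits) ^ b))).
    2:{ intros. now rewrite sum_mul_r. }
    rewrite sum_swap. apply sum_ext. intros l _.
    rewrite sum_one_digit by apply blk_lt. now rewrite pow_digit.
  - rewrite sum_one_digit by apply blk_lt. rewrite !pow_digit. lia.
Qed.

Lemma goal_digits :
  goal = sum q (fun b => degree * 2 ^ a * (2 ^ digit_bits) ^ b)
         + (2 ^ digit_bits) ^ q *
           (q * degree * (2 ^ a * 2 ^ a)
            + 2 ^ (2 * a + r0) *
              (groups * 2 ^ (gam * groups) + sum groups (fun g => 2 ^ (gam * g)))).
Proof.
  unfold goal. rewrite (sum_ext q (fun b => degree * 2 ^ a * 2 ^ (digit_bits * b))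
                          (fun b => degree * 2 ^ a * (2 ^ digit_bits) ^ b)).
  2:{ intros. now rewrite pow_digit. }
  unfold select_shift. rewrite Nat.pow_add_r, (Nat.mul_comm q digit_bits), pow_digit. ring.
Qed.

(** * Digit bounds excluding carries *)

Lemma degree_ge : k <= degree.
Proof.
  clear - hq.
  unfold degree. assert (q ^ (k - 1) <> 0) by (apply Nat.pow_nonzero; lia). nia.
Qed.

Lemma digit_le g al b : digit g al b <= degree * 2 ^ a.
Proof.
  unfold digit. destruct (g <? q ^ k).
  - transitivity (k * 2 ^ a); [|apply Nat.mul_le_mono_r, degree_ge].
    rewrite <- sum_const. apply sum_le. intros l _.
    pose proof (slot_lt al l). destruct (b =? blk g l); lia.
  - destruct (b =? blk g 0); [apply Nat.mul_le_mono_l|]; lia.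
Qed.

Lemma square_digit_le g al : square_digit g al <= degree * (2 ^ a * 2 ^ a).
Proof.
  unfold square_digit. destruct (g <? q ^ k).
  - transitivity (k * (2 ^ a * 2 ^ a)); [|apply Nat.mul_le_mono_r, degree_ge].
    rewrite <- sum_const. apply sum_le. intros l _.
    pose proof (slot_lt al l). apply Nat.mul_le_mono; lia.
  - apply Nat.mul_le_mono_l. lia.
Qed.

Lemma digits_no_carry n x : n <= groups -> x <= n * (degree * 2 ^ a) -> x < 2 ^ digit_bits.
Proof.
  intros Hn Hx. unfold digit_bits. rewrite Nat.pow_add_r.
  assert (2 ^ a <> 0) by (apply Nat.pow_nonzero; lia).
  assert (n * degree <= groups * degree) by now apply Nat.mul_le_mono_r. nia.
Qed.

Lemma squares_no_carry n x :
  n <= groups -> x <= n * (degree * (2 ^ a * 2 ^ a)) -> x < 2 ^ (2 * a + r0).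
Proof.
  intros Hn Hx. replace (2 * a + r0) with (a + a + r0) by lia. rewrite !Nat.pow_add_r.
  assert (2 ^ a * 2 ^ a <> 0) by (apply Nat.neq_mul_0; split; apply Nat.pow_nonzero; lia).
  assert (n * degree <= groups * degree) by now apply Nat.mul_le_mono_r. nia.
Qed.

Lemma low_part_lt (x : nat -> nat) s :
  (forall b, b < q -> x b < 2 ^ digit_bits) -> s < 2 ^ (2 * a + r0) ->
  sum q (fun b => x b * (2 ^ digit_bits) ^ b) + (2 ^ digit_bits) ^ q * s < 2 ^ select_shift.
Proof.
  intros Hx Hs. unfold select_shift.
  rewrite Nat.pow_add_r, (Nat.mul_comm q), pow_digit.
  assert (H : forall n, n <= q ->
     sum n (fun b => x b * (2 ^ digit_bits) ^ b) < (2 ^ digit_bits) ^ n).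
  { induction n; simpl; intros Hn; [lia|].
    specialize (IHn ltac:(lia)). specialize (Hx n ltac:(lia)). nia. }
  specialize (H q (le_n q)). nia.
Qed.

Lemma goal_split : exists L, L < 2 ^ select_shift /\
  goal = L + 2 ^ select_shift *
    (groups * 2 ^ (gam * groups) + sum groups (fun g => 2 ^ (gam * g))).
Proof.
  exists (sum q (fun b => degree * 2 ^ a * (2 ^ digit_bits) ^ b) +
     (2 ^ digit_bits) ^ q * (q * degree * (2 ^ a * 2 ^ a))).
  assert (HG : q <= groups) by (unfold groups; lia). split.
  - apply (low_part_lt (fun _ => degree * 2 ^ a)).
    + intros _ _. apply (digits_no_carry 1); lia.
    + apply (squares_no_carry q); lia.
  - rewrite goal_digits. unfold select_shift.
    rewrite (Nat.pow_add_r 2 (q * digit_bits)), (Nat.mul_comm q digit_bits), pow_digit. ring.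
Qed.

Lemma sum_select_lt : sum groups (fun g => 2 ^ (gam * g)) < 2 ^ (gam * groups).
Proof.
  rewrite Nat.pow_mul_r.
  rewrite (sum_ext _ _ (fun g => (2 ^ gam) ^ g)) by (intros; apply Nat.pow_mul_r).
  apply sum_pow_lt. unfold groups in *. lia.
Qed.

Lemma goal_lt : goal < 2 ^ (select_shift + gam * S groups).
Proof.
  destruct goal_split as (L & HL & ->). pose proof sum_select_lt as H3.
  rewrite (Nat.pow_add_r 2 select_shift), Nat.mul_succ_r, (Nat.pow_add_r 2 (gam * groups) gam).
  set (U := 2 ^ select_shift) in *. set (V := 2 ^ (gam * groups)) in *.
  set (W := sum groups _) in *.
  assert (1 + groups * V + W <= V * 2 ^ gam) by nia.
  nia.
Qed.

Lemma weight_lt g al : g < groups -> weight g al < 2 ^ (select_shift + gam * S groups).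
Proof.
  intros Hg. unfold weight. rewrite low_digits.
  assert (HG : 1 <= groups) by lia.
  assert (H2 : sum q (fun b => digit g al b * (2 ^ digit_bits) ^ b) +
     (2 ^ digit_bits) ^ q * square_digit g al < 2 ^ select_shift).
  { apply low_part_lt.
    - intros b _. apply (digits_no_carry 1); [easy|]. rewrite Nat.mul_1_l. apply digit_le.
    - apply (squares_no_carry 1); [easy|]. rewrite Nat.mul_1_l. apply square_digit_le. }
  assert (H3 : 2 ^ (gam * g) < 2 ^ (gam * groups)).
  { apply Nat.pow_lt_mono_r; [lia|]. destruct gam; [simpl in hgam; lia|nia]. }
  rewrite (Nat.pow_add_r 2 select_shift), Nat.mul_succ_r, (Nat.pow_add_r 2 (gam * groups) gam).
  set (U := 2 ^ select_shift) in *. set (V := 2 ^ (gam * groups)) in *.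
  assert (1 + V + 2 ^ (gam * g) <= V * 2 ^ gam) by nia.
  nia.
Qed.

(** At most [groups] items are chosen, so all digits add without carries and can be compared with
    those of [goal]. The selection digits of [goal] are all 1, so every group occurs exactly
    once. *)
Lemma selection (its : list (nat * nat)) :
  (forall it, In it its -> fst it < groups) ->
  list_sum (map (fun it => weight (fst it) (snd it)) its) = goal ->
  Permutation (map fst its) (seq 0 groups) /\
  (forall b, b < q ->
     list_sum (map (fun it => digit (fst it) (snd it) b) its) = degree * 2 ^ a) /\
  list_sum (map (fun it => square_digit (fst it) (snd it)) its)
    = q * degree * (2 ^ a * 2 ^ a).
Proof.
  intros Hits E.
  assert (HG : q <= groups) by (unfold groups; lia).
  assert (H3 : sum groups (fun g => (2 ^ gam) ^ g) < (2 ^ gam) ^ groups)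
    by (apply sum_pow_lt; lia).
  assert (Esum : sum groups (fun g => 2 ^ (gam * g)) = sum groups (fun g => (2 ^ gam) ^ g))
    by (apply sum_ext; intros; apply Nat.pow_mul_r).
  (* One item more than [groups] would exceed the goal, whose part below the counter is less than
     one counter unit. *)
  assert (Hlen : length its <= groups).
  { assert (Hc : length its * (2 ^ (gam * groups) * 2 ^ select_shift)
                 <= list_sum (map (fun it => weight (fst it) (snd it)) its)).
    { clear. induction its as [|it its IH]; [easy|].
      cbn [length map list_sum fold_right]. change (fold_right Nat.add 0) with list_sum.
      unfold weight at 1. lia. }
    rewrite E in Hc. destruct goal_split as (L & HL & HE). rewrite HE in Hc.
    pose proof sum_select_lt as H4.
    set (U := 2 ^ select_shift) in *. set (V := 2 ^ (gam * groups)) in *.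
    set (W := sum groups (fun g => 2 ^ (gam * g))) in *.
    destruct (le_lt_dec (length its) groups) as [|C]; [easy|].
    assert ((groups + 1) * (V * U) <= length its * (V * U)) by (apply Nat.mul_le_mono_r; lia).
    assert (U * (1 + W) <= U * V) by (apply Nat.mul_le_mono_l; lia). nia. }
  assert (Hexp : list_sum (map (fun it => weight (fst it) (snd it)) its)
    = sum q (fun b => list_sum (map (fun it => digit (fst it) (snd it) b) its)
                      * (2 ^ digit_bits) ^ b)
      + (2 ^ digit_bits) ^ q *
        (list_sum (map (fun it => square_digit (fst it) (snd it)) its)
         + 2 ^ (2 * a + r0) *
           (length its * 2 ^ (gam * groups)
            + list_sum (map (fun g => 2 ^ (gam * g)) (map fst its))))).
  { clear - hk hq hgam hr0. induction its as [|it its IH].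
    - simpl. rewrite (sum_const q 0). lia.
    - cbn [map list_sum fold_right length]. change (fold_right Nat.add 0) with list_sum.
      rewrite IH. unfold weight. rewrite low_digits.
      rewrite (sum_ext q (fun b => (digit _ _ b + _) * _)
         (fun b => digit (fst it) (snd it) b * (2 ^ digit_bits) ^ b
           + list_sum (map (fun it => digit (fst it) (snd it) b) its)
             * (2 ^ digit_bits) ^ b)) by (intros; ring).
      rewrite sum_add. unfold select_shift.
      rewrite (Nat.pow_add_r 2 (q * digit_bits)), (Nat.mul_comm q), pow_digit. ring. }
  rewrite Hexp, goal_digits in E.
  destruct (digits_unique (2 ^ digit_bits) q
    (fun b => list_sum (map (fun it => digit (fst it) (snd it) b) its))
    (fun _ => degree * 2 ^ a) _ _
    ltac:(intros b ?; cbv beta; apply (digits_no_carry (length its)); [easy|];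
          apply list_sum_map_le; intros; apply digit_le)
    ltac:(intros ? ?; cbv beta; apply (digits_no_carry 1); lia) E) as [Ed Etop].
  (* A second use, with a single digit, separates the square digit from the selection part. *)
  destruct (digits_unique (2 ^ (2 * a + r0)) 1
    (fun _ => list_sum (map (fun it => square_digit (fst it) (snd it)) its))
    (fun _ => q * degree * (2 ^ a * 2 ^ a))
    (length its * 2 ^ (gam * groups)
            + list_sum (map (fun g => 2 ^ (gam * g)) (map fst its)))
    (groups * 2 ^ (gam * groups) + sum groups (fun g => 2 ^ (gam * g)))
    ltac:(intros ? ?; cbv beta; apply (squares_no_carry (length its)); [easy|];
          apply list_sum_map_le; intros; apply square_digit_le)
    ltac:(intros ? ?; cbv beta; apply (squares_no_carry q); lia)) as [Es Esel].
  { cbn [sum]. rewrite Nat.pow_0_r, Nat.pow_1_r. lia. }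
  specialize (Es 0 ltac:(lia)). simpl in Es. clear E. rename Esel into E.
  split; [|now split].
  assert (Hfst : forall g, In g (map fst its) -> g < groups).
  { intros g Hg. apply in_map_iff in Hg. destruct Hg as (it & <- & Hit). auto. }
  rewrite Esum, (list_sum_by_count groups) in E by easy.
  rewrite (sum_ext groups (fun g => _ * 2 ^ (gam * g))
     (fun g => count_occ Nat.eq_dec (map fst its) g * (2 ^ gam) ^ g)) in E
    by (intros; now rewrite Nat.pow_mul_r).
  rewrite (Nat.pow_mul_r 2 gam groups) in E.
  pose proof (digits_unique (2 ^ gam) groups
    (count_occ Nat.eq_dec (map fst its)) (fun _ => 1) (length its) groups) as E3.
  destruct E3 as [Hcount _].
  - intros g _. pose proof (count_occ_bound Nat.eq_dec g (map fst its)) as Hb.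
    rewrite length_map in Hb. lia.
  - intros _ _. lia.
  - rewrite (sum_ext groups (fun b => 1 * _) (fun g => (2 ^ gam) ^ g)) by (intros; lia). lia.
  - apply (Permutation_count_occ Nat.eq_dec). intros g.
    destruct (le_lt_dec groups g) as [Hg|Hg].
    + rewrite !(proj1 (count_occ_not_In _ _ _)); [easy| |].
      * intros Hi. apply in_seq in Hi. lia.
      * intros Hi. apply Hfst in Hi. lia.
    + rewrite Hcount by easy. symmetry.
      apply NoDup_count_occ'; [apply seq_NoDup|]. apply in_seq. lia.
Qed.

(* The two digit equations say that, over all slots, the sum of
   [(slot - beta)^2] vanishes, where [beta] is read off the complement items. *)
Lemma consistency (f : nat -> nat) :
  (forall b, b < q -> sum groups (fun g => digit g (f g) b) = degree * 2 ^ a) ->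
  sum groups (fun g => square_digit g (f g)) = q * degree * (2 ^ a * 2 ^ a) ->
  forall g l, g < q ^ k -> l < k -> slot (f g) l = slot (f (q ^ k + blk g l)) 0.
Proof.
  intros Hd Hs.
  set (beta := fun b => slot (f (q ^ k + b)) 0).
  assert (Hbeta : forall b, beta b < 2 ^ a) by (intros; apply slot_lt).
  (* The complement item of [b] contributes [degree * (2 ^ a - beta b)]; the rest of the digit comes
     from the slots of [b]. *)
  assert (Hd' : forall b, b < q ->
    sum (q ^ k) (fun g => sum k (fun l => if b =? blk g l then slot (f g) l else 0))
    = degree * beta b).
  { intros b Hb. specialize (Hd b Hb). unfold groups in Hd. rewrite sum_split in Hd.
    rewrite (sum_ext (q ^ k) _ (fun g =>
      sum k (fun l => if b =? blk g l then slot (f g) l else 0))) in Hd.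
    2:{ intros g Hg. unfold digit. now rewrite (proj2 (Nat.ltb_lt _ _) Hg). }
    rewrite (sum_ext q _ (fun b' => if b' =? b then degree * (2 ^ a - beta b') else 0)) in Hd.
    2:{ intros b' Hb'. unfold digit. rewrite blk_complement by easy.
        replace (q ^ k + b' <? q ^ k) with false by (symmetry; apply Nat.ltb_ge; lia).
        now rewrite Nat.eqb_sym. }
    rewrite sum_indicator in Hd by easy. specialize (Hbeta b).
    rewrite Nat.mul_sub_distr_l in Hd.
    assert (degree * beta b <= degree * 2 ^ a) by (apply Nat.mul_le_mono_l; lia). lia. }
  assert (Hs' : sum (q ^ k) (fun g => sum k (fun l => slot (f g) l * slot (f g) l))
    = degree * sum q (fun b => beta b * beta b)).
  { unfold groups in Hs. rewrite sum_split in Hs.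
    rewrite (sum_ext (q ^ k) _ (fun g => sum k (fun l => slot (f g) l * slot (f g) l))) in Hs.
    2:{ intros g Hg. unfold square_digit. now rewrite (proj2 (Nat.ltb_lt _ _) Hg). }
    rewrite (sum_ext q _ (fun b => degree * (2 ^ a * 2 ^ a - beta b * beta b))) in Hs.
    2:{ intros b' Hb'. unfold square_digit.
        now replace (q ^ k + b' <? q ^ k) with false by (symmetry; apply Nat.ltb_ge; lia). }
    rewrite sum_mul_l in Hs.
    assert (sum q (fun b => 2 ^ a * 2 ^ a - beta b * beta b)
            + sum q (fun b => beta b * beta b) = q * (2 ^ a * 2 ^ a)).
    { rewrite <- sum_add, <- (sum_const q (2 ^ a * 2 ^ a)). apply sum_ext. intros b _.
      assert (beta b * beta b <= 2 ^ a * 2 ^ a)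
        by (apply Nat.mul_le_mono; apply Nat.lt_le_incl, Hbeta). lia. }
    nia. }
  (* By [Hd'], the products of the slots with [beta] have the same total as the squares of the slots
     in [Hs']. *)
  assert (Hcross : sum (q ^ k) (fun g => sum k (fun l => slot (f g) l * beta (blk g l)))
    = degree * sum q (fun b => beta b * beta b)).
  { rewrite <- sum_mul_l.
    rewrite (sum_ext q _ (fun b => sum (q ^ k) (fun g => sum k (fun l =>
       (if b =? blk g l then slot (f g) l else 0) * beta b)))).
    2:{ intros b Hb. rewrite Nat.mul_assoc, <- Hd', <- sum_mul_r by easy.
        apply sum_ext. intros. now rewrite sum_mul_r. }
    rewrite (sum_swap q (q ^ k)). apply sum_ext. intros g _.
    rewrite (sum_swap q k). apply sum_ext. intros l _.
    rewrite <- (sum_indicator q (blk g l) (fun b => slot (f g) l * beta b)) by apply blk_lt.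
    apply sum_ext. intros b _. now destruct (b =? blk g l). }
  intros g l Hg Hl. fold (beta (blk g l)).
  assert (Hle : forall x y, 2 * (x * y) <= x * x + y * y).
  { intros x y. destruct (Nat.le_ge_cases x y) as [H|H];
      apply Nat.le_exists_sub in H; destruct H as (z & -> & _); nia. }
  (* Over all slots, both sides total [2 * degree] times the sum of the squares of [beta], so [Hle]
     must be an equality slot by slot. *)
  assert (Heq : slot (f g) l * slot (f g) l + beta (blk g l) * beta (blk g l)
                = 2 * (slot (f g) l * beta (blk g l))).
  { symmetry.
    refine (sum_eq_termwise k (fun l => 2 * (slot (f g) l * beta (blk g l)))
      (fun l => slot (f g) l * slot (f g) l + beta (blk g l) * beta (blk g l)) _ _ l Hl).
    - intros; apply Hle.
    - refine (sum_eq_termwise (q ^ k)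
        (fun g => sum k (fun l => 2 * (slot (f g) l * beta (blk g l))))
        (fun g => sum k (fun l => slot (f g) l * slot (f g) l + beta (blk g l) * beta (blk g l)))
        _ _ g Hg).
      + intros; apply sum_le; intros; apply Hle.
      + rewrite (sum_ext _ _ (fun g => 2 * sum k (fun l => slot (f g) l * beta (blk g l))))
          by (intros; apply sum_mul_l).
        rewrite sum_mul_l, Hcross.
        rewrite (sum_ext (q ^ k) (fun g => sum k (fun l => _ + _)) (fun g =>
          sum k (fun l => slot (f g) l * slot (f g) l)
          + sum k (fun l => beta (blk g l) * beta (blk g l)))) by (intros; apply sum_add).
        rewrite sum_add, Hs', (sum_over_slots (fun b => beta b * beta b)). lia. }
  clear - Heq. nia.
Qed.

Lemma goal_reached_sound (its : list (nat * nat)) :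
  (forall it, In it its -> fst it < groups) ->
  list_sum (map (fun it => weight (fst it) (snd it)) its) = goal ->
  exists f beta,
    (forall g, g < groups -> In (g, f g) its) /\
    (forall g l, g < q ^ k -> l < k -> slot (f g) l = beta (blk g l)).
Proof.
  intros Hits E.
  destruct (selection its Hits E) as (P & Hd & Hs).
  apply permutation_of_graph in P. destruct P as [f P].
  exists f, (fun b => slot (f (q ^ k + b)) 0). split.
  - intros g Hg. apply (Permutation_in _ (Permutation_sym P)).
    apply (in_map (fun g => (g, f g))), in_seq. lia.
  - apply consistency.
    + intros b Hb. rewrite <- (Hd b Hb), <- list_sum_map_seq.
      rewrite (list_sum_permutation _ _ (Permutation_map _ P)), map_map. easy.
    + rewrite <- Hs, <- list_sum_map_seq.
      rewrite (list_sum_permutation _ _ (Permutation_map _ P)), map_map. easy.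
Qed.

Lemma goal_reached_complete (f beta : nat -> nat) :
  (forall b, b < q -> beta b < 2 ^ a) ->
  (forall g l, g < groups -> l < k -> slot (f g) l = beta (blk g l)) ->
  sum groups (fun g => weight g (f g)) = goal.
Proof.
  intros Hbeta Hf. unfold weight. rewrite sum_add, sum_mul_r, sum_add, sum_const.
  unfold goal. f_equal. unfold groups at 1. rewrite sum_split.
  rewrite (sum_ext (q ^ k) _ (fun g => sum k (fun l =>
    (fun b => beta b * 2 ^ (digit_bits * b) + beta b * beta b * 2 ^ (digit_bits * q)) (blk g l)))).
  2:{ intros g Hg. unfold low. rewrite (proj2 (Nat.ltb_lt _ _) Hg).
      apply sum_ext. intros l Hl. rewrite Hf; [easy| |easy]. unfold groups; lia. }
  rewrite (sum_over_slots (fun b => beta b * 2 ^ (digit_bits * b)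
    + beta b * beta b * 2 ^ (digit_bits * q))), <- sum_mul_l.
  rewrite (sum_ext q (fun i => low _ _) (fun b =>
    degree * (2 ^ a - beta b) * 2 ^ (digit_bits * b)
    + degree * (2 ^ a * 2 ^ a - beta b * beta b) * 2 ^ (digit_bits * q))).
  2:{ intros b Hb. unfold low.
      replace (q ^ k + b <? q ^ k) with false by (symmetry; apply Nat.ltb_ge; lia).
      rewrite Hf by (unfold groups; lia). now rewrite blk_complement. }
  rewrite <- sum_add.
  replace (q * degree * (2 ^ a * 2 ^ a) * 2 ^ (digit_bits * q))
    with (sum q (fun _ => degree * (2 ^ a * 2 ^ a) * 2 ^ (digit_bits * q)))
    by (rewrite sum_const; ring).
  rewrite <- sum_add. apply sum_ext. intros b Hb. specialize (Hbeta b Hb).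
  assert (beta b * beta b <= 2 ^ a * 2 ^ a) by (apply Nat.mul_le_mono; lia).
  transitivity (degree * (beta b + (2 ^ a - beta b)) * 2 ^ (digit_bits * b)
    + degree * (beta b * beta b + (2 ^ a * 2 ^ a - beta b * beta b)) * 2 ^ (digit_bits * q));
    [ring|].
  do 3 f_equal; lia.
Qed.

End Items.

(** * Assignments and clauses *)

Fixpoint number (f : nat -> bool) (n : nat) : nat :=
  match n with
  | 0 => 0
  | S n' => 2 * number (fun i => f (S i)) n' + Nat.b2n (f 0)
  end.

Lemma testbit_number n : forall f i, i < n -> Nat.testbit (number f n) i = f i.
Proof.
  induction n; cbn [number]; intros f i Hi; [lia|].
  destruct i as [|i].
  - apply Nat.testbit_0_r.
  - rewrite Nat.testbit_succ_r, IHn by lia. easy.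
Qed.

Lemma number_lt n : forall f, number f n < 2 ^ n.
Proof.
  induction n; cbn [number]; intros f; [simpl; lia|].
  specialize (IHn (fun i => f (S i))). rewrite Nat.pow_succ_r'.
  destruct (f 0); simpl Nat.b2n; lia.
Qed.

Lemma testbit_ge_false x n i : x < 2 ^ n -> n <= i -> Nat.testbit x i = false.
Proof.
  intros Hx Hi. rewrite <- (Nat.mod_small x (2 ^ n)) by easy.
  now apply Nat.mod_pow2_bits_high.
Qed.

Lemma testbit_slot a al l i : i < a ->
  Nat.testbit (slot a al l) i = Nat.testbit al (a * l + i).
Proof.
  intros Hi. unfold slot. rewrite Nat.mod_pow2_bits_low by easy.
  rewrite Nat.div_pow2_bits. f_equal. lia.
Qed.

Lemma slot_eq_number a al l f :
  (forall i, i < a -> Nat.testbit al (a * l + i) = f i) -> slot a al l = number f a.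
Proof.
  intros H. apply Nat.bits_inj. intros i.
  destruct (le_lt_dec a i) as [Hi|Hi].
  - rewrite (testbit_ge_false (slot a al l) a) by (try apply slot_lt; easy).
    now rewrite (testbit_ge_false (number f a) a) by (try apply number_lt; easy).
  - now rewrite testbit_slot, testbit_number, H.
Qed.

Section Formula.

Variables (k q a r0 gam : nat) (phi : cnf).

(* [P] encodes the values of the variables from [q * a] on; the item [(g, al)]
   fixes the variables of the blocks [blk q g i], [i < k]. *)
Definition literal_false (P g al : nat) (l : literal) : bool :=
  if fst l <? q * a then
    existsb (fun i => (blk q g i =? fst l / a) &&
      negb (eqb (Nat.testbit al (a * i + fst l mod a)) (snd l))) (seq 0 k)
  else negb (eqb (Nat.testbit P (fst l - q * a)) (snd l)).

(** A literal on a block outside the tuple never counts as false, so an item is rejected only for a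
    clause that its blocks and the prefix falsify entirely. Complement items undergo the same test;
    items read off a satisfying assignment pass it in every group. *)
Definition item_ok (P g al : nat) : bool :=
  (g <? groups k q) &&
  negb (existsb (fun C => forallb (literal_false P g al) C) phi).

Notation wt := (weight k q a r0 gam).
Notation target := (goal k q a r0 gam).

Definition items_of (P : nat) (M : list nat) : Prop :=
  forall x, In x M -> exists g al, item_ok P g al = true /\ x = wt g al.

Hypothesis hk : 1 <= k.
Hypothesis hq : 1 <= q.
Hypothesis hgam : groups k q < 2 ^ gam.
Hypothesis hr0 : groups k q * degree k q < 2 ^ r0.

(** Read in base [q], any list of blocks, repetitions allowed, is the index of a tuple; hence some
    group sees all block literals of a given clause. *)
Lemma tuple_covering (B : list nat) :
  (forall b, In b B -> b < q) ->
  exists g, g < q ^ length B /\ forall i, i < length B -> blk q g i = nth i B 0.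
Proof.
  clear hk hgam hr0. induction B as [|b B IH]; intros HB.
  - exists 0. split; simpl; intros; lia.
  - destruct IH as (g & Hg & H); [intros; apply HB; now right|].
    assert (Hb : b < q) by (apply HB; now left).
    exists (g * q + b). split.
    + cbn [length]. rewrite Nat.pow_succ_r'. nia.
    + intros [|i] Hi; unfold blk; simpl nth; cbn [length] in Hi.
      * rewrite Nat.pow_0_r, Nat.div_1_r, Nat.add_comm, Nat.Div0.mod_add.
        now apply Nat.mod_small.
      * rewrite Nat.pow_succ_r', <- Nat.Div0.div_div.
        rewrite Nat.div_add_l, (Nat.div_small b), Nat.add_0_r by lia.
        apply H. lia.
Qed.

(** The item chosen in a group covering the blocks of a clause leaves one of its literals not false,
    and the slots of this item agree with the common block values [beta]. *)
Lemma goal_sound (P : nat) (M : list nat) :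
  (forall C, In C phi -> length C <= k) ->
  items_of P M -> subset_sum M target -> satisfiable phi.
Proof.
  intros Hphi HM (sub & rest & HP & Hsum).
  assert (Hits : exists its : list (nat * nat),
    (forall it, In it its -> item_ok P (fst it) (snd it) = true) /\
    sub = map (fun it => wt (fst it) (snd it)) its).
  { assert (Hsub : items_of P sub).
    { intros x Hx. apply HM. apply (Permutation_in _ HP), in_or_app. now left. }
    clear HP Hsum. induction sub as [|x sub IH].
    - exists []. split; [easy|reflexivity].
    - destruct IH as (its & H1 & ->); [intros y Hy; apply Hsub; now right|].
      destruct (Hsub x (or_introl eq_refl)) as (g & al & Hok & ->).
      exists ((g, al) :: its). split; [|reflexivity].
      intros it [<-|Hit]; auto. }
  destruct Hits as (its & Hok & ->).
  destruct (goal_reached_sound k q a r0 gam hk hq hgam hr0 its) as (f & beta & Hf & Hbeta).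
  { intros it Hit. apply Hok in Hit. apply andb_true_iff in Hit. now apply Nat.ltb_lt. }
  { easy. }
  exists (fun v => if v <? q * a then Nat.testbit (beta (v / a)) (v mod a)
                   else Nat.testbit P (v - q * a)).
  intros C HC.
  (* Literals on prefix variables, and the padding up to length [k], use block [0] as a dummy. *)
  set (B := map (fun l => if fst l <? q * a then fst l / a else 0) C
            ++ repeat 0 (k - length C)).
  destruct (tuple_covering B) as (g & Hg & Hblk).
  { intros b Hb. apply in_app_or in Hb. destruct Hb as [Hb|Hb].
    - apply in_map_iff in Hb. destruct Hb as (l & <- & _).
      destruct (Nat.ltb_spec (fst l) (q * a)); [|lia].
      apply Nat.Div0.div_lt_upper_bound. lia.
    - apply repeat_spec in Hb. lia. }
  assert (HlenB : length B = k).
  { unfold B. rewrite length_app, length_map, repeat_length, Nat.add_comm.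
    now apply Nat.sub_add, Hphi. }
  rewrite HlenB in *.
  assert (Hokg : item_ok P g (f g) = true).
  { apply (Hok (g, f g)), Hf. unfold groups. lia. }
  apply andb_true_iff in Hokg. destruct Hokg as [_ Hokg].
  apply negb_true_iff in Hokg.
  assert (Hl : exists l, In l C /\ literal_false P g (f g) l = false).
  { destruct (forallb (literal_false P g (f g)) C) eqn:E.
    - rewrite (proj2 (existsb_exists _ _)) in Hokg; [easy|]. now exists C.
    - clear - E. induction C as [|l C IH]; [easy|].
      simpl in E. apply andb_false_iff in E. destruct E as [E|E].
      + exists l. split; [now left|easy].
      + destruct (IH E) as (l' & ? & ?). exists l'. split; [now right|easy]. }
  destruct Hl as (l & HlC & Hl). exists l. split; [easy|].
  unfold literal_false in Hl.
  destruct (Nat.ltb_spec (fst l) (q * a)) as [Hv|Hv].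
  - destruct (In_nth C l (0, true) HlC) as (i & Hi & Hnth).
    assert (Hik : i < k) by (specialize (Hphi C HC); lia).
    assert (HB : blk q g i = fst l / a).
    { rewrite Hblk by easy. unfold B. rewrite app_nth1 by (rewrite length_map; easy).
      rewrite nth_indep with (d' := (fun l => if fst l <? q * a then fst l / a else 0) (0, true))
        by (rewrite length_map; easy).
      rewrite (map_nth (fun l => if fst l <? q * a then fst l / a else 0)).
      change (nth i C (0, true)) with (@nth (nat * bool) i C (0, true)) in *. rewrite Hnth.
      now rewrite (proj2 (Nat.ltb_lt _ _) Hv). }
    rewrite <- HB, <- Hbeta by easy.
    assert (Hm : fst l mod a < a) by (apply Nat.mod_upper_bound; lia).
    rewrite testbit_slot by easy.
    destruct (eqb (Nat.testbit (f g) (a * i + fst l mod a)) (snd l)) eqn:E;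
      [now apply eqb_prop|].
    enough (existsb (fun i => (blk q g i =? fst l / a) &&
      negb (eqb (Nat.testbit (f g) (a * i + fst l mod a)) (snd l))) (seq 0 k) = true)
      by congruence.
    apply existsb_exists. exists i. split; [apply in_seq; lia|].
    now rewrite HB, Nat.eqb_refl, E.
  - apply negb_false_iff in Hl. now apply eqb_prop.
Qed.

Lemma goal_complete (m : nat) :
  q * a <= m ->
  (forall C, In C phi -> forall l, In l C -> fst l < m) ->
  satisfiable phi ->
  exists P f, P < 2 ^ (m - q * a) /\
    (forall g, g < groups k q -> f g < 2 ^ (k * a) /\ item_ok P g (f g) = true) /\
    sum (groups k q) (fun g => wt g (f g)) = target.
Proof.
  intros Hqa Hphi (sigma & Hsigma).
  exists (number (fun i => sigma (q * a + i)) (m - q * a)).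
  (* Slot [l] of the item for [g] spells out [sigma] on the block [blk q g l], bit by bit. *)
  set (f := fun g => number (fun i => sigma (a * blk q g (i / a) + i mod a)) (k * a)).
  assert (Hbit : forall g l i, l < k -> i < a ->
    Nat.testbit (f g) (a * l + i) = sigma (a * blk q g l + i)).
  { intros g l i Hl Hi. unfold f. rewrite testbit_number by nia.
    rewrite (Nat.mul_comm a l), Nat.div_add_l, (Nat.div_small i), Nat.add_0_r by lia.
    rewrite (Nat.add_comm (l * a)), Nat.Div0.mod_add, Nat.mod_small by easy. easy. }
  exists f. split; [apply number_lt|]. split.
  - intros g Hg. split; [apply number_lt|].
    unfold item_ok. rewrite (proj2 (Nat.ltb_lt _ _) Hg). simpl.
    apply negb_true_iff, not_true_is_false. intros E.
    apply existsb_exists in E. destruct E as (C & HC & E).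
    destruct (Hsigma C HC) as (l & Hl & Hs).
    rewrite forallb_forall in E. specialize (E l Hl). unfold literal_false in E.
    assert (Hv := Hphi C HC l Hl).
    destruct (Nat.ltb_spec (fst l) (q * a)) as [H|H].
    + apply existsb_exists in E. destruct E as (i & Hi & E).
      apply in_seq in Hi. apply andb_true_iff in E. destruct E as [E1 E2].
      apply Nat.eqb_eq in E1.
      assert (fst l mod a < a) by (apply Nat.mod_upper_bound; lia).
      rewrite Hbit, E1, <- Nat.div_mod_eq, Hs, eqb_reflx in E2 by lia. easy.
    + rewrite testbit_number in E by lia.
      replace (q * a + (fst l - q * a)) with (fst l) in E by lia.
      rewrite Hs, eqb_reflx in E. easy.
  - apply (goal_reached_complete k q a r0 gam hk hq hgam hr0 f
             (fun b => number (fun i => sigma (a * b + i)) a)).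
    + intros. apply number_lt.
    + intros g l Hg Hl. apply slot_eq_number. intros i Hi. now apply Hbit.
Qed.

End Formula.

(** * The sequence of operations *)

Fixpoint final (M : list nat) (ops : list operation) : list nat :=
  match ops with [] => M | o :: ops' => final (update o M) ops' end.

(** The k-SAT answer is the disjunction of all query answers, so only the existence of a positive
    query matters. *)
Fixpoint hits (M : list nat) (ops : list operation) : Prop :=
  match ops with
  | [] => False
  | o :: ops' =>
      match o with Query t => subset_sum M t | _ => False end \/ hits (update o M) ops'
  end.

Lemma final_app ops1 : forall M ops2, final M (ops1 ++ ops2) = final (final M ops1) ops2.
Proof. induction ops1; simpl; auto. Qed.

Lemma hits_app ops1 : forall M ops2,
  hits M (ops1 ++ ops2) <-> hits M ops1 \/ hits (final M ops1) ops2.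
Proof.
  induction ops1 as [|o ops1 IH]; simpl; intros M ops2; [tauto|].
  rewrite IH. tauto.
Qed.

Lemma valid_app t ops1 : forall M ops2,
  valid t M (ops1 ++ ops2) <-> valid t M ops1 /\ valid t (final M ops1) ops2.
Proof.
  induction ops1 as [|o ops1 IH]; simpl; intros M ops2; [tauto|].
  rewrite IH. tauto.
Qed.

Lemma remove_one_permutation x M : In x M -> Permutation M (x :: remove_one x M).
Proof.
  induction M as [|y M IH]; simpl; [easy|]. intros [->|H].
  - rewrite Nat.eqb_refl. reflexivity.
  - destruct (Nat.eqb_spec x y) as [->|_]; [reflexivity|].
    rewrite (IH H) at 1. apply perm_swap.
Qed.

Lemma incl_NoDup_permutation {X} (us : list X) : forall L,
  NoDup us -> incl us L -> exists rest, Permutation (us ++ rest) L.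
Proof.
  induction us as [|u us IH]; intros L Hnd Hincl; [now exists L|].
  destruct (in_split u L) as (L1 & L2 & ->); [now apply Hincl; left|].
  apply NoDup_cons_iff in Hnd. destruct Hnd as [Hu Hnd].
  destruct (IH (L1 ++ L2) Hnd) as (rest & HP).
  - intros x Hx. assert (Hx' := Hincl x (or_intror Hx)).
    apply in_app_or in Hx'. apply in_or_app.
    destruct Hx' as [|[->|]]; [now left|easy|now right].
  - exists rest. simpl. rewrite HP. apply Permutation_middle.
Qed.

Section Operations.

Variables (k q a r0 gam : nat) (phi : cnf).

Notation wt := (weight k q a r0 gam).
Notation target := (goal k q a r0 gam).
Notation ok P u := (item_ok k q a phi P (u / 2 ^ (k * a)) (u mod 2 ^ (k * a))).
Notation wt_at u := (wt (u / 2 ^ (k * a)) (u mod 2 ^ (k * a))).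

(* Phase 0 inserts the items with prefix [P], phase 2 deletes them; everything
   else, in particular an index [u] of no admissible item, is a query of the
   target, which is harmless at any time. *)
Definition phase_op (P h u : nat) : operation :=
  if (h =? 0) && ok P u then Insert (wt_at u)
  else if (h =? 2) && ok P u then Delete (wt_at u)
  else Query target.

(** Every operation is a function of its index alone, so the program generates the sequence without
    storing it. Padding to four phases of equal length makes the total length a power of two. *)
Definition op_at (j : nat) : operation :=
  phase_op (j / 2 ^ (gam + k * a) / 4) ((j / 2 ^ (gam + k * a)) mod 4)
    (j mod 2 ^ (gam + k * a)).

Definition op_sequence (p1 : nat) : list operation :=
  map op_at (seq 0 (2 ^ p1 * (4 * 2 ^ (gam + k * a)))).

Variables (m tmax : nat).
Hypothesis hk : 1 <= k.
Hypothesis hq : 1 <= q.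
Hypothesis hgam : groups k q < 2 ^ gam.
Hypothesis hr0 : groups k q * degree k q < 2 ^ r0.
Hypothesis hphi : is_kcnf k m phi.
Hypothesis htmax : target <= tmax.

Definition inserted (P : nat) (us : list nat) : list nat :=
  map (fun u => wt_at u) (filter (fun u => ok P u) us).

Lemma goal_sound_kcnf P M :
  items_of k q a r0 gam phi P M -> subset_sum M target -> satisfiable phi.
Proof.
  apply goal_sound; auto. intros C HC. now apply hphi.
Qed.

(** Filler queries may come while the insertion is incomplete. They are safe because [goal_sound]
    holds for any multiset of admissible items of one prefix. *)
Lemma insert_phase P us : forall M,
  items_of k q a r0 gam phi P M ->
  let ops := map (phase_op P 0) us in
  valid tmax M ops /\ (hits M ops -> satisfiable phi) /\
  Permutation (final M ops) (inserted P us ++ M) /\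
  items_of k q a r0 gam phi P (final M ops).
Proof.
  induction us as [|u us IH]; intros M HM; cbn [map valid hits final].
  - repeat split; easy.
  - assert (Hop : phase_op P 0 u = if ok P u then Insert (wt_at u) else Query target)
      by reflexivity.
    rewrite Hop. unfold inserted. cbn [filter].
    destruct (ok P u) eqn:E; cbn [update allowed].
    + destruct (IH (wt_at u :: M)) as (H1 & H2 & H3 & H4).
      { intros x [<-|Hx]; [now exists (u / 2 ^ (k * a)), (u mod 2 ^ (k * a))|auto]. }
      repeat split; auto.
      * intros [[]|H]; auto.
      * rewrite H3. cbn [map app]. symmetry. apply Permutation_middle.
    + destruct (IH M HM) as (H1 & H2 & H3 & H4).
      repeat split; auto. intros [H|H]; auto. now apply (goal_sound_kcnf P M).
Qed.

Lemma query_phase P h us M :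
  h <> 0 -> h <> 2 -> items_of k q a r0 gam phi P M ->
  let ops := map (phase_op P h) us in
  valid tmax M ops /\ (hits M ops -> satisfiable phi) /\
  (us <> [] -> subset_sum M target -> hits M ops) /\ final M ops = M.
Proof.
  intros H0 H2 HM.
  assert (E : forall u, phase_op P h u = Query target).
  { intros u. unfold phase_op.
    now rewrite (proj2 (Nat.eqb_neq h 0)), (proj2 (Nat.eqb_neq h 2)). }
  induction us as [|u us IH]; cbn [map valid hits final].
  - repeat split; easy.
  - rewrite E. cbn [update allowed]. destruct IH as (H3 & H4 & H5 & H6).
    repeat split; auto. intros [H|H]; auto. now apply (goal_sound_kcnf P M).
Qed.

(** The current multiset is, up to permutation, what remains to be deleted; this makes each deletion
    valid. *)
Lemma delete_phase P us : forall M,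
  Permutation M (inserted P us) -> items_of k q a r0 gam phi P M ->
  let ops := map (phase_op P 2) us in
  valid tmax M ops /\ (hits M ops -> satisfiable phi) /\ final M ops = [].
Proof.
  induction us as [|u us IH]; intros M HP HM; cbn [map valid hits final].
  - repeat split; try easy. apply Permutation_nil. now symmetry.
  - assert (Hop : phase_op P 2 u = if ok P u then Delete (wt_at u) else Query target)
      by reflexivity.
    rewrite Hop. unfold inserted in HP. cbn [filter] in HP.
    destruct (ok P u) eqn:E; cbn [update allowed].
    + cbn [map] in HP.
      assert (Hin : In (wt_at u) M).
      { apply (Permutation_in _ (Permutation_sym HP)). now left. }
      pose proof (remove_one_permutation _ _ Hin) as HR.
      destruct (IH (remove_one (wt_at u) M)) as (H1 & H2 & H3).
      * apply (Permutation_cons_inv (a := wt_at u)). now rewrite <- HR.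
      * intros x Hx. apply HM. apply (Permutation_in _ (Permutation_sym HR)). now right.
      * repeat split; auto. intros [[]|H]; auto.
    + destruct (IH M HP HM) as (H1 & H2 & H3).
      repeat split; auto. intros [H|H]; auto. now apply (goal_sound_kcnf P M).
Qed.

Notation size := (2 ^ (gam + k * a)).

Definition prefix_ops (P : nat) : list operation :=
  map (phase_op P 0) (seq 0 size) ++ map (phase_op P 1) (seq 0 size)
  ++ map (phase_op P 2) (seq 0 size) ++ map (phase_op P 3) (seq 0 size).

Lemma prefix_ops_correct P :
  valid tmax [] (prefix_ops P) /\ final [] (prefix_ops P) = [] /\
  (hits [] (prefix_ops P) -> satisfiable phi) /\
  (subset_sum (inserted P (seq 0 size)) target -> hits [] (prefix_ops P)).
Proof.
  destruct (insert_phase P (seq 0 size) []) as (V0 & H0 & F0 & I0); [easy|].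
  cbv zeta in *. rewrite app_nil_r in F0.
  set (M := final [] _) in *.
  destruct (query_phase P 1 (seq 0 size) M) as (V1 & H1 & C1 & F1); try easy.
  destruct (delete_phase P (seq 0 size) M) as (V2 & H2 & F2); try easy.
  destruct (query_phase P 3 (seq 0 size) []) as (V3 & H3 & _ & F3); try easy.
  unfold prefix_ops.
  rewrite !valid_app, !final_app, !hits_app. fold M. rewrite F1, F2, F3.
  repeat split; auto.
  - tauto.
  - intros (sub & rest & HP & Hs). right. left. apply C1.
    + assert (size <> 0) by now apply Nat.pow_nonzero. now destruct size.
    + exists sub, rest. split; [|easy]. now rewrite HP.
Qed.

Lemma seq_shift_map s n : seq s n = map (fun u => s + u) (seq 0 n).
Proof.
  revert s. induction n; intros s; simpl; [easy|].
  rewrite Nat.add_0_r. f_equal. rewrite IHn, <- seq_shift, map_map.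
  apply map_ext. intros; lia.
Qed.

Lemma op_at_phase P h u : h < 4 -> u < size -> op_at ((P * 4 + h) * size + u) = phase_op P h u.
Proof.
  clear - k. intros Hh Hu. unfold op_at.
  assert (size <> 0) by now apply Nat.pow_nonzero.
  rewrite Nat.div_add_l, (Nat.div_small u), Nat.add_0_r by easy.
  rewrite (Nat.add_comm (_ * size)), Nat.Div0.mod_add, (Nat.mod_small u) by easy.
  rewrite Nat.div_add_l, (Nat.div_small h), Nat.add_0_r by easy.
  rewrite (Nat.add_comm (P * 4)), Nat.Div0.mod_add, (Nat.mod_small h) by easy. easy.
Qed.

Lemma map_op_at_prefix P :
  map op_at (seq (P * (4 * size)) (4 * size)) = prefix_ops P.
Proof.
  assert (H : forall h, h < 4 ->
    map op_at (seq ((P * 4 + h) * size) size) = map (phase_op P h) (seq 0 size)).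
  { intros h Hh. rewrite seq_shift_map, map_map. apply map_ext_in.
    intros u Hu. apply in_seq in Hu. apply op_at_phase; lia. }
  unfold prefix_ops. rewrite <- (H 0), <- (H 1), <- (H 2), <- (H 3) by lia.
  rewrite <- !map_app. f_equal.
  replace ((P * 4 + 3) * size) with ((P * 4 + 2) * size + size) by lia.
  rewrite <- seq_app.
  replace ((P * 4 + 2) * size) with ((P * 4 + 1) * size + size) by lia.
  rewrite <- seq_app.
  replace ((P * 4 + 1) * size) with ((P * 4 + 0) * size + size) by lia.
  rewrite <- seq_app. f_equal; lia.
Qed.

Lemma op_sequence_prefixes n :
  let ops := map op_at (seq 0 (n * (4 * size))) in
  valid tmax [] ops /\ final [] ops = [] /\ (hits [] ops -> satisfiable phi) /\
  (forall P, P < n -> hits [] (prefix_ops P) -> hits [] ops).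
Proof.
  induction n as [|n IH]; cbv zeta.
  - simpl. repeat split; easy.
  - replace (S n * (4 * size)) with (n * (4 * size) + 4 * size) by lia.
    rewrite seq_app, map_app, Nat.add_0_l, map_op_at_prefix.
    destruct IH as (V & F & S1 & C1).
    destruct (prefix_ops_correct n) as (V' & F' & S1' & _).
    rewrite valid_app, final_app, hits_app, F.
    repeat split; auto.
    + tauto.
    + intros P HP Hh. rewrite hits_app, F.
      destruct (Nat.eq_dec P n) as [->|]; [now right|]. left. apply (C1 P); [lia|easy].
Qed.

(** [p1] may exceed the number of prefix variables: surplus prefixes are still sound and make the
    sequence as long as desired. *)
Lemma op_sequence_correct p1 :
  q * a <= m -> m - q * a <= p1 ->
  valid tmax [] (op_sequence p1) /\ (hits [] (op_sequence p1) <-> satisfiable phi).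
Proof.
  intros Hqa Hp1. unfold op_sequence.
  destruct (op_sequence_prefixes (2 ^ p1)) as (V & _ & S1 & C1).
  split; [easy|]. split; [easy|]. intros Hsat.
  destruct (goal_complete k q a r0 gam phi hk hq hgam hr0 m Hqa) as (P & f & HP & Hf & Hsum);
    [intros C HC; now apply hphi|easy|].
  apply (C1 P).
  { eapply Nat.lt_le_trans; [exact HP|]. now apply Nat.pow_le_mono_r. }
  apply prefix_ops_correct. rewrite <- Hsum, <- list_sum_map_seq.
  (* [F g] is the index, within a phase, of the item with group [g] and slots [f g]. *)
  set (F := fun g => g * 2 ^ (k * a) + f g).
  assert (Hka : 2 ^ (k * a) <> 0) by now apply Nat.pow_nonzero.
  assert (HF : forall g, g < groups k q ->
     F g / 2 ^ (k * a) = g /\ F g mod 2 ^ (k * a) = f g).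
  { intros g Hg. destruct (Hf g Hg) as [Hlt _]. unfold F. split.
    - rewrite Nat.div_add_l, (Nat.div_small (f g)) by easy. lia.
    - rewrite Nat.add_comm, Nat.Div0.mod_add. now apply Nat.mod_small. }
  destruct (incl_NoDup_permutation (map F (seq 0 (groups k q)))
    (filter (fun u => ok P u) (seq 0 size))) as (rest & HP').
  - apply NoDup_map_NoDup_ForallPairs; [|apply seq_NoDup].
    intros x y Hx Hy E. apply in_seq in Hx, Hy.
    rewrite <- (proj1 (HF x ltac:(lia))), <- (proj1 (HF y ltac:(lia))). now rewrite E.
  - intros u Hu. apply in_map_iff in Hu. destruct Hu as (g & <- & Hg).
    apply in_seq in Hg. destruct (HF g ltac:(lia)) as [E1 E2].
    destruct (Hf g ltac:(lia)) as [Hlt Hok].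
    apply filter_In. split.
    + apply in_seq. unfold F. rewrite Nat.pow_add_r. nia.
    + now rewrite E1, E2.
  - exists (map (fun u => wt_at u) (map F (seq 0 (groups k q)))), (map (fun u => wt_at u) rest).
    split; [unfold inserted; rewrite <- map_app; now apply Permutation_map|].
    rewrite map_map. f_equal. apply map_ext_in. intros g Hg. apply in_seq in Hg.
    destruct (HF g ltac:(lia)) as [-> ->]. easy.
Qed.

End Operations.

(** * Running programs *)

Lemma word_some B x v : word B x = Some v <-> x < B /\ x = v.
Proof.
  unfold word. destruct (Nat.ltb_spec x B); split; intros H'.
  - now injection H'.
  - now destruct H' as [_ ->].
  - easy.
  - lia.
Qed.

Lemma eval_lt B s e v : eval B s e = Some v -> v < B.
Proof.
  destruct e as [n|a i|o x y]; cbn [eval].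
  - intros H. apply word_some in H. lia.
  - destruct (eval B s i); [|easy]. intros H. apply word_some in H. lia.
  - destruct (eval B s x), (eval B s y); try easy. intros H. apply word_some in H. lia.
Qed.

Lemma div_le x y : x / y <= x.
Proof.
  destruct (Nat.eq_dec y 0) as [->|]; [cbn; lia|].
  apply Nat.Div0.div_le_upper_bound. nia.
Qed.

(** * Simulating a program in shifted arrays *)

Section Shift.

Variable off : nat.

Fixpoint shift_expr (e : expr) : expr :=
  match e with
  | Const n => Const n
  | Cell a i => Cell (off + a) (shift_expr i)
  | Bin o x y => Bin o (shift_expr x) (shift_expr y)
  end.

Fixpoint shift_cmd (p : cmd) : cmd :=
  match p with
  | Skip => Skip
  | Assign a i x => Assign (off + a) (shift_expr i) (shift_expr x)
  | Seq p q => Seq (shift_cmd p) (shift_cmd q)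
  | If x p q => If (shift_expr x) (shift_cmd p) (shift_cmd q)
  | While x p => While (shift_expr x) (shift_cmd p)
  end.

Definition hosts (s S : memory) : Prop := forall a i, S (off + a) i = s a i.

Lemma cost_shift e : cost (shift_expr e) = cost e.
Proof. induction e; simpl; congruence. Qed.

Lemma eval_shift B B' s S e v :
  B <= B' -> hosts s S -> eval B s e = Some v -> eval B' S (shift_expr e) = Some v.
Proof.
  intros HB Hs. revert v. induction e as [n|a i IH|o x IHx y IHy]; intros v; cbn [eval shift_expr].
  - rewrite !word_some. lia.
  - destruct (eval B s i) as [j|]; [|easy]. rewrite (IH j eq_refl), Hs, !word_some. lia.
  - destruct (eval B s x) as [u|]; [|easy]. destruct (eval B s y) as [w|]; [|easy].
    rewrite (IHx u eq_refl), (IHy w eq_refl), !word_some. lia.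
Qed.

(** Operations never wrap around, so a run that does not overflow at capacity [B] has the same
    values at the larger [B']; arrays below [off] are out of its reach. *)
Lemma exec_shift B B' p s T s' :
  B <= B' -> exec B p s T s' -> forall S, hosts s S ->
  exists S', exec B' (shift_cmd p) S T S' /\ hosts s' S' /\
             forall a i, a < off -> S' a i = S a i.
Proof.
  intros HB H. induction H; intros S0 HS; cbn [shift_cmd].
  - exists S0. repeat split; auto. constructor.
  - exists (write S0 (off + a) j v). split; [|split].
    + rewrite <- (cost_shift i), <- (cost_shift x).
      constructor; eapply eval_shift; eauto.
    + intros a' i'. unfold write. rewrite HS.
      replace (off + a' =? off + a) with (a' =? a); [easy|].
      destruct (Nat.eqb_spec a' a), (Nat.eqb_spec (off + a') (off + a)); lia.
    + intros a' i' Ha. unfold write.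
      now replace (a' =? off + a) with false by (symmetry; apply Nat.eqb_neq; lia).
  - destruct (IHexec1 _ HS) as (S1 & E1 & H1 & F1).
    destruct (IHexec2 _ H1) as (S2 & E2 & H2 & F2).
    exists S2. split; [econstructor; eauto|]. split; [easy|].
    intros. now rewrite F2, F1.
  - destruct (IHexec _ HS) as (S1 & E1 & H2 & F1).
    exists S1. split; [|easy]. rewrite <- (cost_shift x).
    eapply exec_If_true; eauto using eval_shift.
  - destruct (IHexec _ HS) as (S1 & E1 & H2 & F1).
    exists S1. split; [|easy]. rewrite <- (cost_shift x).
    eapply exec_If_false; eauto using eval_shift.
  - destruct (IHexec1 _ HS) as (S1 & E1 & H3 & F1).
    destruct (IHexec2 _ H3) as (S2 & E2 & H4 & F2).
    exists S2. split; [|split; [easy|]].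
    + rewrite <- (cost_shift x). eapply exec_While_true; eauto using eval_shift.
    + intros. now rewrite F2, F1.
  - exists S0. split; [|easy]. rewrite <- (cost_shift x).
    apply exec_While_false. eauto using eval_shift.
Qed.

End Shift.

(** Reading a value not below the capacity is stuck, so the answer cell of the simulated program has
    to be known to be small. *)
Lemma exec_bounded B B' p s T s' :
  B <= B' -> exec B p s T s' -> (forall a i, s a i < B') -> forall a i, s' a i < B'.
Proof.
  intros HB H. induction H; intros Hs; auto.
  intros a' i'. unfold write. apply eval_lt in H0. destruct (_ && _)%bool; [lia|apply Hs].
Qed.

(** A total-correctness triple with time budget [t], used in weakest-precondition style. *)
Definition runs (B : nat) (p : cmd) (s : memory) (t : nat) (Q : memory -> Prop) : Prop :=
  exists T s', exec B p s T s' /\ T <= t /\ Q s'.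

(* Meaningful for loop-free commands only. *)
Fixpoint time (p : cmd) : nat :=
  match p with
  | Skip => 1
  | Assign _ i x => S (cost i + cost x)
  | Seq p q => S (time p + time q)
  | If x p q => S (cost x + (time p + time q))
  | While _ _ => 0
  end.

Section Rules.

Variable B : nat.

Lemma runs_weaken p s t t' (Q Q' : memory -> Prop) :
  runs B p s t Q -> t <= t' -> (forall s', Q s' -> Q' s') -> runs B p s t' Q'.
Proof. intros (T & s' & H & Ht & HQ) Hle HQQ. exists T, s'. repeat split; auto. lia. Qed.

Lemma runs_skip s (Q : memory -> Prop) : Q s -> runs B Skip s (time Skip) Q.
Proof. intros H. exists 1, s. repeat split; auto. constructor. Qed.

Lemma runs_assign a i x s j v (Q : memory -> Prop) :
  eval B s i = Some j -> eval B s x = Some v -> Q (write s a j v) ->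
  runs B (Assign a i x) s (time (Assign a i x)) Q.
Proof. intros Hi Hx H. do 2 eexists. split; [now constructor; eauto|]. split; easy. Qed.

Lemma runs_seq p q s t t' Q :
  runs B p s t (fun s' => runs B q s' t' Q) -> runs B (Seq p q) s (S (t + t')) Q.
Proof.
  intros (T & s1 & H1 & Ht & T' & s2 & H2 & Ht' & HQ).
  exists (S (T + T')), s2. split; [now econstructor; eauto|]. split; [lia|easy].
Qed.

Lemma runs_seq_time p q s Q :
  runs B p s (time p) (fun s' => runs B q s' (time q) Q) ->
  runs B (Seq p q) s (time (Seq p q)) Q.
Proof. apply runs_seq. Qed.

Lemma runs_if x p q s v Q :
  eval B s x = Some v ->
  (v <> 0 -> runs B p s (time p) Q) -> (v = 0 -> runs B q s (time q) Q) ->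
  runs B (If x p q) s (time (If x p q)) Q.
Proof.
  intros Hx Hp Hq. destruct (Nat.eq_dec v 0) as [E|E].
  - destruct (Hq E) as (T & s' & H & Ht & HQ). subst.
    exists (S (cost x + T)), s'. split; [now apply exec_If_false|]. split; [simpl; lia|easy].
  - destruct (Hp E) as (T & s' & H & Ht & HQ).
    exists (S (cost x + T)), s'. split; [now eapply exec_If_true; eauto|].
    split; [simpl; lia|easy].
Qed.

Lemma runs_while_false x p s Q :
  eval B s x = Some 0 -> Q s -> runs B (While x p) s (S (cost x)) Q.
Proof. intros Hx HQ. do 2 eexists. split; [now apply exec_While_false|]. split; easy. Qed.

Lemma runs_while_true x p s v t t' Q :
  eval B s x = Some v -> v <> 0 ->
  runs B p s t (fun s' => runs B (While x p) s' t' Q) ->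
  runs B (While x p) s (S (cost x + t + t')) Q.
Proof.
  intros Hx Hv (T & s1 & H1 & Ht & T' & s2 & H2 & Ht' & HQ).
  exists (S (cost x + T + T')), s2. split; [now eapply exec_While_true; eauto|].
  split; [lia|easy].
Qed.

Lemma eval_const s n : n < B -> eval B s (Const n) = Some n.
Proof. intros. now apply word_some. Qed.

Lemma eval_cell s a i j v :
  eval B s i = Some j -> s a j = v -> v < B -> eval B s (Cell a i) = Some v.
Proof. intros H1 H2 H3. cbn [eval]. rewrite H1. apply word_some. lia. Qed.

Lemma eval_bin s o x y u v :
  eval B s x = Some u -> eval B s y = Some v -> eval_binop o u v < B ->
  eval B s (Bin o x y) = Some (eval_binop o u v).
Proof. intros H1 H2 H3. cbn [eval]. rewrite H1, H2. now apply word_some. Qed.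

Lemma eval_add s x y u v :
  eval B s x = Some u -> eval B s y = Some v -> u + v < B ->
  eval B s (Bin Add x y) = Some (u + v).
Proof. apply (eval_bin s Add). Qed.

Lemma eval_mul s x y u v :
  eval B s x = Some u -> eval B s y = Some v -> u * v < B ->
  eval B s (Bin Mul x y) = Some (u * v).
Proof. apply (eval_bin s Mul). Qed.

Lemma eval_shl s x y u v :
  eval B s x = Some u -> eval B s y = Some v -> u * 2 ^ v < B ->
  eval B s (Bin Shl x y) = Some (u * 2 ^ v).
Proof. rewrite <- Nat.shiftl_mul_pow2. apply (eval_bin s Shl). Qed.

Lemma eval_sub s x y u v :
  eval B s x = Some u -> eval B s y = Some v -> eval B s (Bin Sub x y) = Some (u - v).
Proof.
  intros H1 H2. apply (eval_bin s Sub); auto. apply eval_lt in H1. simpl. lia.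
Qed.

Lemma eval_div s x y u v :
  eval B s x = Some u -> eval B s y = Some v -> eval B s (Bin Div x y) = Some (u / v).
Proof.
  intros H1 H2. apply (eval_bin s Div); auto. apply eval_lt in H1.
  cbn [eval_binop]. eapply Nat.le_lt_trans; [apply div_le|exact H1].
Qed.

Lemma eval_shr s x y u v :
  eval B s x = Some u -> eval B s y = Some v -> eval B s (Bin Shr x y) = Some (u / 2 ^ v).
Proof.
  rewrite <- Nat.shiftr_div_pow2. intros H1 H2. apply (eval_bin s Shr); auto.
  cbn [eval_binop]. rewrite Nat.shiftr_div_pow2. apply eval_lt in H1.
  eapply Nat.le_lt_trans; [apply div_le|exact H1].
Qed.

Lemma eval_mod s x y u v :
  eval B s x = Some u -> eval B s y = Some v -> eval B s (Bin Mod x y) = Some (u mod v).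
Proof.
  intros H1 H2. apply (eval_bin s Mod); auto. apply eval_lt in H1.
  cbn [eval_binop]. eapply Nat.le_lt_trans; [apply Nat.Div0.mod_le|exact H1].
Qed.

Lemma eval_eq s x y u v :
  1 < B -> eval B s x = Some u -> eval B s y = Some v ->
  eval B s (Bin Eq x y) = Some (Nat.b2n (u =? v)).
Proof.
  intros HB H1 H2. apply (eval_bin s Eq); auto. simpl. destruct (u =? v); simpl; lia.
Qed.

Lemma eval_ltb s x y u v :
  1 < B -> eval B s x = Some u -> eval B s y = Some v ->
  eval B s (Bin Lt x y) = Some (Nat.b2n (u <? v)).
Proof.
  intros HB H1 H2. apply (eval_bin s Lt); auto. simpl. destruct (u <? v); simpl; lia.
Qed.

(** [k] and [q] are constants of the program, so sums over them are unrolled into expressions of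
    constant cost. *)
Fixpoint sum_expr (n : nat) (f : nat -> expr) : expr :=
  match n with 0 => Const 0 | S n' => Bin Add (sum_expr n' f) (f n') end.

Lemma eval_sum s n f F :
  sum n F < B -> (forall i, i < n -> eval B s (f i) = Some (F i)) ->
  eval B s (sum_expr n f) = Some (sum n F).
Proof.
  induction n; cbn [sum sum_expr]; intros HB Hf.
  - apply eval_const. lia.
  - apply eval_add; [apply IHn; [lia|auto]|auto|easy].
Qed.

Lemma eval_conv s e v v' : eval B s e = Some v' -> v' = v -> eval B s e = Some v.
Proof. now intros ? <-. Qed.

End Rules.

Definition var (i : nat) : expr := Cell 2 (Const i).
Definition set (i : nat) (x : expr) : cmd := Assign 2 (Const i) x.

Lemma eval_var B s i v : i < B -> s 2 i = v -> v < B -> eval B s (var i) = Some v.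
Proof. intros H1 H2 H3. eapply eval_cell; eauto. now apply eval_const. Qed.

Lemma runs_set B i x s v (Q : memory -> Prop) :
  i < B -> eval B s x = Some v -> Q (write s 2 i v) -> runs B (set i x) s (time (set i x)) Q.
Proof. intros. eapply runs_assign; eauto. now apply eval_const. Qed.

(** * The program for k-SAT *)

Declare Scope expr_scope.
Delimit Scope expr_scope with E.
Notation "x + y" := (Bin Add x y) : expr_scope.
Notation "x - y" := (Bin Sub x y) : expr_scope.
Notation "x * y" := (Bin Mul x y) : expr_scope.
Notation "x / y" := (Bin Div x y) : expr_scope.
Notation "x 'mod' y" := (Bin Mod x y) : expr_scope.
Notation "x << y" := (Bin Shl x y) (at level 35, right associativity) : expr_scope.
Notation "x >> y" := (Bin Shr x y) (at level 35, right associativity) : expr_scope.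
Notation "x == y" := (Bin Eq x y) (at level 70) : expr_scope.
Notation "x < y" := (Bin Lt x y) : expr_scope.
Notation "# n" := (Const n) (at level 5, n at level 5, format "# n").
Notation "p ;; q" := (Seq p q) (at level 96, right associativity).

Lemma le_mul_pos x y : 1 <= x -> y <= x * y.
Proof. nia. Qed.

Lemma slot_offset_le x i y n : y < x -> i < n -> x * i + y <= n * x.
Proof. nia. Qed.

Lemma le_mul_pow2 x n : x <= x * 2 ^ n.
Proof. rewrite Nat.mul_comm. apply le_mul_pos. now apply Nat.neq_0_lt_0, Nat.pow_nonzero. Qed.

Section Program.

Variables (k q r0 gam D extra tau : nat) (p : cmd).

(** The part of [goal] above [select_shift]; being independent of [m], it can be a literal of the
    program. *)
Definition select_sum : nat :=
  groups k q * 2 ^ (gam * groups k q) + sum (groups k q) (fun g => 2 ^ (gam * g)).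

(* Array 0 holds the formula, array 1 the answer, and array [3 + i] is array [i]
   of the simulated data structure.  The cells of array 2 hold, from 0 on:
   [a], [q a], [k a], the bits per digit, [2 ^ a], the shift of the selection
   digits, the bits of an item index, the number of operations, the target;
   9: operation index; 10-14: prefix, phase, group, slots, index within the
   phase; 15: is the item admissible; 16: clauses left; 17: input position;
   18: literals left; 19: is the clause false; 20-21: literal and variable;
   22-23: opcode and operand. *)
Definition init : cmd :=
  set 0 (Cell 0 #0 / #D)%E;;
  set 1 (#q * var 0)%E;;
  set 2 (#k * var 0)%E;;
  set 3 (var 0 + #r0)%E;;
  set 4 (#1 << var 0)%E;;
  set 5 (#q * var 3 + (#2 * var 0 + #r0))%E;;
  set 6 (#gam + var 2)%E;;
  (* Cell 10 holds [log_ops] until [decode] reuses it for the prefix. *)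
  set 10 ((Cell 0 #0 - var 1) + #(extra + 2) + var 6)%E;;
  set 7 (#1 << var 10)%E;;
  set 8 (sum_expr q (fun b => (#(degree k q) * var 4) << (var 3 * #b))
         + ((#(q * degree k q) * (var 4 * var 4)) << (var 3 * #q))
         + (#select_sum << var 5))%E;;
  (* Array 3 is the input array of the simulated program; its cells 2 and 3 receive the [tmax] and
     the word length that [processes] provides. *)
  Assign 3 #2%E (#1 << (var 5 + #(gam * S (groups k q) + tau)))%E;;
  Assign 3 #3%E (var 10 + #1)%E.

Definition decode : cmd :=
  set 10 ((var 9 >> var 6) / #4)%E;;
  set 11 ((var 9 >> var 6) mod #4)%E;;
  set 14 (var 9 mod (#1 << var 6))%E;;
  set 12 (var 14 / (#1 << var 2))%E;;
  set 13 (var 14 mod (#1 << var 2))%E;;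
  set 15 (var 12 < #(groups k q))%E;;
  set 16 (Cell 0 #1)%E;;
  set 17 #2%E.

Definition blk_expr (l : nat) : expr := ((var 12 / #(q ^ l)) mod #q)%E.
Definition slot_expr (l : nat) : expr := ((var 13 >> (var 0 * #l)) mod var 4)%E.

(** Boolean logic in arithmetic: product for conjunction, [1 - x] for negation, positivity of a sum
    for existence. Cell 19 stays 1 as long as every literal read is false. *)
Definition scan_literal : cmd :=
  set 20 (Cell 0 (var 17));;
  set 17 (var 17 + #1)%E;;
  set 18 (var 18 - #1)%E;;
  set 21 (var 20 / #2)%E;;
  If (var 21 < var 1)%E
    (set 19 (var 19 * (#0 < sum_expr k (fun l =>
       (blk_expr l == (var 21 / var 0)) *
       (#1 - (((var 13 >> (var 0 * #l + (var 21 mod var 0))) mod #2) == (var 20 mod #2))))))%E)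
    (set 19 (var 19 * (#1 - (((var 10 >> (var 21 - var 1)) mod #2) == (var 20 mod #2))))%E).

Definition clause_head : cmd :=
  set 18 (Cell 0 (var 17));;
  set 17 (var 17 + #1)%E;;
  set 19 #1%E.

Definition clause_tail : cmd :=
  set 15 (var 15 * (#1 - var 19))%E;;
  set 16 (var 16 - #1)%E.

Definition scan_clause : cmd := clause_head;; While (var 18) scan_literal;; clause_tail.

Definition low_cmd : cmd :=
  If (var 12 < #(q ^ k))%E
    (set 23 (sum_expr k (fun l =>
       (slot_expr l << (var 3 * blk_expr l))
       + ((slot_expr l * slot_expr l) << (var 3 * #q))))%E)
    (set 23 (((#(degree k q) * (var 4 - slot_expr 0)) << (var 3 * blk_expr 0))
       + ((#(degree k q) * (var 4 * var 4 - slot_expr 0 * slot_expr 0))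
          << (var 3 * #q)))%E).

Definition weight_cmd : cmd :=
  low_cmd;;
  set 23 (var 23 + ((#(2 ^ (gam * groups k q)) + (#1 << (#gam * var 12))) << var 5))%E.

(** The weight is computed for admissible items only, since for an index beyond the last group it
    might overflow. The test for phase 2 is itself the opcode: 0 inserts, 1 deletes. *)
Definition choose_op : cmd :=
  If (var 15 * ((var 11 == #0) + (var 11 == #2)))%E
    (set 22 (var 11 == #2)%E;;
     weight_cmd)
    (set 22 #2%E;; set 23 (var 8));;
  Assign 3 #0%E (var 22);;
  Assign 3 #1%E (var 23).

Definition collect : cmd :=
  If (var 22 == #2)%E (If (Cell 4 #0%E) (Assign 1 #0%E #1%E) Skip) Skip;;
  set 9 (var 9 + #1)%E.

Definition step : cmd :=
  decode;; While (var 16) scan_clause;; choose_op;; shift_cmd 3 p;; collect.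

Definition sat_program : cmd :=
  init;; While (var 9 < var 7)%E step.

Variables (m : nat) (phi : cnf) (B : nat).

Definition block_size : nat := m / D.
Definition prefix_bits : nat := m - q * block_size + extra.
(** The summand 2 stands for the four phases. *)
Definition log_ops : nat := m - q * block_size + (extra + 2) + (gam + k * block_size).
(** [tau] raises [tmax] above the threshold from which the amortized bound is assumed. *)
Definition log_tmax : nat :=
  select_shift q block_size r0 + (gam * S (groups k q) + tau).

(** A crude bound on the literals of the program, each of which has to fit in a word. *)
Definition constants_bound : nat :=
  30 + D + k + q + r0 + gam + groups k q + q ^ k + degree k q + q * degree k q
  + 2 * 2 ^ (gam * groups k q) + gam * S (groups k q) + tau + extra + select_sum.

Notation a := block_size.
Notation db := (digit_bits a r0).
Notation shift := (select_shift q a r0).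
Notation target := (goal k q a r0 gam).
Notation input := (encode_cnf m phi).
Notation op j := (op_at k q a r0 gam phi j).

Hypothesis hk : 1 <= k.
Hypothesis hq : 1 <= q.
Hypothesis hgam : groups k q < 2 ^ gam.
Hypothesis hr0 : groups k q * degree k q < 2 ^ r0.
Hypothesis hphi : is_kcnf k m phi.
Hypothesis hqa : q * a <= m.
Hypothesis hlog : log_tmax <= log_ops.
Hypothesis hB : 2 ^ log_ops + log_ops + 2 * m + length input + constants_bound < B.

Definition ready (s : memory) : Prop :=
  (forall i, s 0 i = nth i input 0) /\
  s 2 0 = a /\ s 2 1 = q * a /\ s 2 2 = k * a /\ s 2 3 = db /\ s 2 4 = 2 ^ a /\
  s 2 5 = shift /\ s 2 6 = gam + k * a /\ s 2 7 = 2 ^ log_ops /\ s 2 8 = target.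

(* Working variables are numbered so that each command only writes cells from
   some index [lo] on. *)
Definition frame (lo : nat) (s s' : memory) : Prop :=
  forall b i, b <> 2 \/ i < lo -> s' b i = s b i.

Lemma frame_refl lo s : frame lo s s.
Proof. easy. Qed.

Lemma frame_write lo s s' i v : frame lo s s' -> lo <= i -> frame lo s (write s' 2 i v).
Proof.
  intros H Hi b i' Hb. rewrite <- H by easy. unfold write.
  destruct (Nat.eqb_spec b 2), (Nat.eqb_spec i' i); simpl; lia.
Qed.

Lemma frame_trans lo lo' s s' s'' : lo <= lo' -> frame lo s s' -> frame lo' s' s'' -> frame lo s s''.
Proof. intros Hl H1 H2 b i Hb. rewrite H2, H1 by (destruct Hb; [now left|right; lia]). easy. Qed.

Lemma ready_cells s s' :
  ready s -> (forall i, s' 0 i = s 0 i) -> (forall i, i < 9 -> s' 2 i = s 2 i) -> ready s'.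
Proof.
  intros (H & H0 & H1 & H2 & H3 & H4 & H5 & H6 & H7 & H8) F0 F2.
  repeat split; intros; rewrite ?F0, ?F2 by lia; auto.
Qed.

Lemma ready_frame s s' : ready s -> frame 9 s s' -> ready s'.
Proof.
  intros H F. apply (ready_cells s); [easy|intros; apply F; now left|intros; apply F; now right].
Qed.


Ltac rd := unfold write; cbn [Nat.eqb andb].

Ltac ev :=
  lazymatch goal with
  | |- eval _ _ (Const _) = _ => apply eval_const
  | |- eval _ _ (var _) = _ => apply eval_var; [|rd; first [eassumption|reflexivity]|]
  | |- eval _ _ (Bin Add _ _) = _ => apply eval_add; [ev|ev|]
  | |- eval _ _ (Bin Mul _ _) = _ => apply eval_mul; [ev|ev|]
  | |- eval _ _ (Bin Sub _ _) = _ => apply eval_sub; [ev|ev]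
  | |- eval _ _ (Bin Div _ _) = _ => apply eval_div; [ev|ev]
  | |- eval _ _ (Bin Mod _ _) = _ => apply eval_mod; [ev|ev]
  | |- eval _ _ (Bin Shl _ _) = _ => apply eval_shl; [ev|ev|]
  | |- eval _ _ (Bin Shr _ _) = _ => apply eval_shr; [ev|ev]
  | |- eval _ _ (Bin Eq _ _) = _ => apply eval_eq; [|ev|ev]
  | |- eval _ _ (Bin Lt _ _) = _ => apply eval_ltb; [|ev|ev]
  | |- eval _ _ (Cell _ _) = _ => eapply eval_cell; [ev|rd; first [eassumption|reflexivity]|]
  | |- _ => idtac
  end.

Tactic Notation "step_set" uconstr(val) :=
  try apply runs_seq_time;
  apply runs_set with (v := val);
  [lia|eapply eval_conv; [ev; lia|rewrite ?Nat.mul_1_l; first [assumption|lia|reflexivity]]|].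

(** * Verification of initialization and decoding *)

Lemma tmax_le : 2 ^ log_tmax <= 2 ^ log_ops.
Proof. now apply Nat.pow_le_mono_r. Qed.

Lemma target_lt : target < 2 ^ log_tmax.
Proof.
  eapply Nat.lt_le_trans; [now apply goal_lt|].
  apply Nat.pow_le_mono_r; [easy|]. unfold log_tmax. clear. lia.
Qed.

Lemma init_runs :
  runs B init (input_memory input) (time init) (fun s' =>
    ready s' /\ s' 2 9 = 0 /\ s' 1 0 = 0 /\
    hosts 3 (input_memory [0; 0; 2 ^ log_tmax; S log_ops]) s').
Proof.
  pose proof tmax_le as Ht. pose proof target_lt as Hg.
  assert (Hsh : shift < 2 ^ shift) by (apply Nat.pow_gt_lin_r; lia).
  assert (Hsh' : 2 ^ shift <= 2 ^ log_tmax)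
    by (apply Nat.pow_le_mono_r; [easy|unfold log_tmax; lia]).
  assert (Hshift : q * db + (2 * a + r0) <= shift) by reflexivity.
  assert (Ha : a <= q * a) by (apply le_mul_pos; exact hq).
  assert (HA : 2 ^ a <= 2 ^ shift) by (apply Nat.pow_le_mono_r; lia).
  (* The target is split into its three summands: partial results of its evaluation are then bounded
     by the target itself, which is below [2 ^ log_tmax]. *)
  assert (Htarget := eq_refl target). unfold goal at 2 in Htarget.
  fold select_sum in Htarget.
  set (s0 := sum q _) in Htarget. set (s1 := q * degree k q * _ * _) in Htarget.
  set (s2 := _ * 2 ^ shift) in Htarget.
  unfold constants_bound in hB.
  assert (Hlog : m - q * a + (extra + 2) + (gam + k * a) <= log_ops) by reflexivity.
  assert (Hdb : a + r0 <= db) by reflexivity.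
  assert (Hdb' : db <= q * db) by (apply le_mul_pos; exact hq).
  assert (Hin : forall i, input_memory input 0 i = nth i input 0) by reflexivity.
  assert (Hz : forall b i, input_memory input (S b) i = 0) by reflexivity.
  assert (Hm : input_memory input 0 0 = m) by reflexivity.
  set (s := input_memory input) in *. clearbody s.
  unfold init.
  step_set (a).
  step_set (q * a).
  step_set (k * a).
  step_set (db).
  step_set (2 ^ a).
  step_set (shift).
  step_set (gam + k * a).
  step_set log_ops.
  step_set (2 ^ log_ops).
  apply runs_seq_time; apply runs_set with (v := target); [lia| |].
  { eapply eval_conv; [|symmetry; exact Htarget].
    assert (Hq : db * q <= shift) by lia.
    apply eval_add; [apply eval_add|ev|]; try lia.
    - apply eval_sum; [fold s0; lia|]. intros i Hi.
      assert (Hi' := sum_term_le q (fun b => degree k q * 2 ^ a * 2 ^ (db * b)) i Hi).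
      fold s0 in Hi'. cbv beta in Hi'.
      assert (Hi2 := le_mul_pow2 (degree k q * 2 ^ a) (db * i)).
      assert (db * i <= db * q) by (apply Nat.mul_le_mono_l; lia).
      ev; lia.
    - assert (Hs1 := le_mul_pow2 (q * degree k q * (2 ^ a * 2 ^ a)) (db * q)). fold s1 in Hs1.
      assert (HA2 : 2 ^ a * 2 ^ a <= q * degree k q * (2 ^ a * 2 ^ a)).
      { apply le_mul_pos. eapply Nat.le_trans; [|apply le_mul_pos, hq].
        eapply Nat.le_trans; [exact hk|]. apply degree_ge, hq. }
      eapply eval_conv; [ev|reflexivity]; fold s1; try lia.
    }
  apply runs_seq_time. apply runs_assign with (j := 2) (v := 2 ^ log_tmax).
  { ev. lia. }
  { eapply eval_conv; [ev|apply Nat.mul_1_l]; fold log_tmax; lia. }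
  eapply runs_assign with (j := 3) (v := S log_ops).
  { ev. lia. }
  { eapply eval_conv; [ev|]; lia. }
  split; [|split; [rd; apply Hz|split; [rd; apply Hz|]]].
  - repeat split; rd; auto.
  - intros b i. rd. destruct b as [|b]; [|apply Hz].
    destruct i as [|[|[|[|i]]]]; try reflexivity; [apply Hz..|].
    cbn. rewrite Hz. now destruct i.
Qed.

Lemma skipn_cons {X} n (l r : list X) x d :
  skipn n l = x :: r -> n < length l /\ nth n l d = x /\ skipn (S n) l = r.
Proof.
  revert l. induction n; intros l H.
  - destruct l; [easy|]. simpl in H. injection H as -> ->. simpl. repeat split; lia.
  - destruct l as [|y l]; [easy|]. simpl in H. destruct (IHn l H) as (H1 & H2 & H3).
    simpl. repeat split; auto. lia.
Qed.

Lemma length_flat_map_ge {X Y} (f : X -> list Y) l :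
  (forall x, In x l -> 1 <= length (f x)) -> length l <= length (flat_map f l).
Proof.
  induction l as [|x l IH]; intros H; [easy|].
  cbn [flat_map length]. rewrite length_app.
  assert (1 <= length (f x)) by (apply H; now left).
  assert (length l <= length (flat_map f l)) by (apply IH; intros; apply H; now right). lia.
Qed.

Lemma length_phi_le : length phi <= length input.
Proof.
  unfold encode_cnf. cbn [length]. do 2 apply Nat.le_le_succ_r.
  apply length_flat_map_ge. intros. cbn. lia.
Qed.

Notation prefix_at j := (j / 2 ^ (gam + k * a) / 4).
Notation phase_at j := ((j / 2 ^ (gam + k * a)) mod 4).
Notation group_at j := (j mod 2 ^ (gam + k * a) / 2 ^ (k * a)).
Notation slots_at j := ((j mod 2 ^ (gam + k * a)) mod 2 ^ (k * a)).

Lemma pow_le_ops e : e <= log_ops -> 2 ^ e <= 2 ^ log_ops.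
Proof. now apply Nat.pow_le_mono_r. Qed.

Lemma decode_runs s j :
  ready s -> s 2 9 = j -> j < 2 ^ log_ops ->
  runs B decode s (time decode) (fun s' =>
    frame 10 s s' /\ s' 2 10 = prefix_at j /\ s' 2 11 = phase_at j /\
    s' 2 12 = group_at j /\ s' 2 13 = slots_at j /\
    s' 2 15 = Nat.b2n (group_at j <? groups k q) /\ s' 2 16 = length phi /\ s' 2 17 = 2).
Proof.
  intros (Hin & H0 & H1 & H2 & H3 & H4 & H5 & H6 & H7 & H8) Hj Hlt.
  assert (Hphi : s 0 1 = length phi) by apply Hin.
  pose proof length_phi_le as Hlen.
  unfold constants_bound in hB.
  assert (Hlog : m - q * a + (extra + 2) + (gam + k * a) <= log_ops) by reflexivity.
  assert (Hp1 := pow_le_ops (gam + k * a) ltac:(lia)).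
  assert (Hp2 := pow_le_ops (k * a) ltac:(lia)).
  assert (Hu := Nat.Div0.mod_le j (2 ^ (gam + k * a))).
  assert (Hg : group_at j <= j).
  { eapply Nat.le_trans; [apply div_le|exact Hu]. }
  unfold decode.
  step_set (prefix_at j).
  step_set (phase_at j).
  step_set (j mod 2 ^ (gam + k * a)).
  step_set (group_at j).
  step_set (slots_at j).
  step_set (Nat.b2n (group_at j <? groups k q)).
  step_set (length phi).
  step_set 2.
  split; [repeat (apply frame_write; [|lia]); apply frame_refl|].
  repeat split.
Qed.

(** * Verification of the admissibility test *)

Lemma b2n_bound b : Nat.b2n b <= 1.
Proof. destruct b; simpl; lia. Qed.

Lemma b2n_lt_sum n (f : nat -> bool) :
  Nat.b2n (0 <? sum n (fun i => Nat.b2n (f i))) = Nat.b2n (existsb f (seq 0 n)).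
Proof.
  induction n; [easy|].
  rewrite seq_S, existsb_app. cbn [sum existsb Nat.add].
  destruct (existsb f (seq 0 n)); destruct (f n);
    cbn [orb Nat.b2n] in *; destruct (Nat.ltb_spec 0 (sum n (fun i => Nat.b2n (f i))));
    cbn [Nat.b2n] in *; try discriminate;
    destruct (Nat.ltb_spec 0 (sum n (fun i => Nat.b2n (f i)) + 1)),
      (Nat.ltb_spec 0 (sum n (fun i => Nat.b2n (f i)) + 0)); simpl; lia.
Qed.

Lemma b2n_mismatch x i b :
  1 - Nat.b2n ((x / 2 ^ i) mod 2 =? Nat.b2n b) = Nat.b2n (negb (eqb (Nat.testbit x i) b)).
Proof.
  rewrite <- Nat.testbit_spec'. now destruct (Nat.testbit x i), b.
Qed.

Lemma b2n_mul b c : Nat.b2n b * Nat.b2n c = Nat.b2n (b && c).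
Proof. now destruct b, c. Qed.

Lemma b2n_product_le b x : Nat.b2n b * (1 - x) <= 1.
Proof. destruct b; cbn [Nat.b2n]; lia. Qed.

Definition scanning (s : memory) (P g al : nat) : Prop :=
  ready s /\ s 2 10 = P /\ s 2 12 = g /\ s 2 13 = al /\ P < B /\ g < B /\ al < B.

Lemma scan_literal_runs s P g al l rest n b :
  scanning s P g al -> skipn (s 2 17) input = encode_literal l :: rest -> fst l < m ->
  s 2 18 = n -> n < B -> s 2 19 = Nat.b2n b ->
  runs B scan_literal s (time scan_literal) (fun s' =>
    frame 17 s s' /\ s' 2 17 = S (s 2 17) /\ s' 2 18 = n - 1 /\
    s' 2 19 = Nat.b2n (b && literal_false k q a P g al l)).
Proof.
  intros ((Hin & H0 & H1 & H2 & H3 & H4 & H5 & H6 & H7 & H8) & HP & Hg & Hal & HPB & HgB & HalB)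
    Hskip Hl Hn HnB Hb.
  destruct (skipn_cons _ _ _ _ 0 Hskip) as (Hlen & Hnth & _).
  rewrite <- Hin in Hnth.
  set (ptr := s 2 17) in *. assert (Hptr : s 2 17 = ptr) by reflexivity. clearbody ptr.
  assert (Henc : encode_literal l = 2 * fst l + Nat.b2n (snd l)) by reflexivity.
  pose proof (b2n_bound (snd l)). pose proof (b2n_bound b).
  unfold constants_bound in hB.
  assert (Hv : encode_literal l / 2 = fst l).
  { rewrite Henc. symmetry. apply Nat.div_unique with (Nat.b2n (snd l)); lia. }
  assert (Hs : encode_literal l mod 2 = Nat.b2n (snd l)).
  { rewrite Henc. symmetry. apply Nat.mod_unique with (fst l); lia. }
  assert (Hencb : encode_literal l < B) by lia. clear Henc.
  assert (Ha : a <= q * a) by (apply le_mul_pos; exact hq).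
  assert (Hka : k * a <= log_ops) by (unfold log_ops; lia).
  unfold scan_literal.
  step_set (encode_literal l).
  step_set (S ptr).
  step_set (n - 1).
  step_set (fst l).
  assert (Hpost : forall s' c, frame 17 s s' -> s' 2 17 = S ptr -> s' 2 18 = n - 1 ->
    c = literal_false k q a P g al l ->
    frame 17 s (write s' 2 19 (Nat.b2n (b && c))) /\
    write s' 2 19 (Nat.b2n (b && c)) 2 17 = S ptr /\
    write s' 2 19 (Nat.b2n (b && c)) 2 18 = n - 1 /\
    write s' 2 19 (Nat.b2n (b && c)) 2 19 = Nat.b2n (b && literal_false k q a P g al l)).
  { intros s' c F Hc1 Hc2 ->. split; [|repeat split; auto].
    apply frame_write; [easy|lia]. }
  eapply runs_if; [ev; lia| |]; intros Hcond.
  - assert (Hlt : fst l < q * a) by (destruct (Nat.ltb_spec (fst l) (q * a)); easy).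
    assert (Hmod : fst l mod a < a) by (apply Nat.mod_upper_bound; lia).
    set (c := existsb (fun i => (blk q g i =? fst l / a) &&
      negb (eqb (Nat.testbit al (a * i + fst l mod a)) (snd l))) (seq 0 k)).
    apply runs_set with (v := Nat.b2n (b && c)); [lia| |].
    + pose proof (b2n_bound c).
      rewrite <- b2n_mul. apply eval_mul; [ev; lia| |rewrite b2n_mul; pose proof (b2n_bound (b && c)); lia].
      unfold c. rewrite <- b2n_lt_sum. apply eval_ltb; [lia|ev; lia|].
      assert (Hsum : sum k (fun i => Nat.b2n ((blk q g i =? fst l / a) &&
         negb (eqb (Nat.testbit al (a * i + fst l mod a)) (snd l)))) <= k).
      { rewrite <- (Nat.mul_1_r k) at 2. rewrite <- sum_const. apply sum_le.
        intros. apply b2n_bound. }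
      apply eval_sum; [lia|]. intros i Hi.
      assert (Hpow : q ^ i <= q ^ k) by (apply Nat.pow_le_mono_r; lia).
      assert (Hai := slot_offset_le a i (fst l mod a) k Hmod Hi).
      rewrite <- b2n_mul, <- b2n_mismatch.
      eapply eval_conv;
        [unfold blk_expr; ev; first [lia|eapply Nat.le_lt_trans; [apply b2n_product_le|lia]]|].
      rewrite Hs. reflexivity.
    + apply Hpost; auto.
      * repeat (apply frame_write; [|lia]). apply frame_refl.
      * unfold literal_false. now rewrite (proj2 (Nat.ltb_lt _ _) Hlt).
  - assert (Hge : q * a <= fst l) by (destruct (Nat.ltb_spec (fst l) (q * a)); easy).
    set (c := negb (eqb (Nat.testbit P (fst l - q * a)) (snd l))).
    apply runs_set with (v := Nat.b2n (b && c)); [lia| |].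
    + eapply eval_conv;
        [ev; first [lia|eapply Nat.le_lt_trans; [apply b2n_product_le|lia]]|].
      rewrite Hs, b2n_mismatch. apply b2n_mul.
    + apply Hpost; auto.
      * repeat (apply frame_write; [|lia]). apply frame_refl.
      * unfold literal_false. now rewrite (proj2 (Nat.ltb_ge _ _) Hge).
Qed.

Lemma scanning_frame s s' P g al : scanning s P g al -> frame 15 s s' -> scanning s' P g al.
Proof.
  intros (H & H1 & H2 & H3 & H4) F.
  refine (conj _ (conj _ (conj _ (conj _ H4)))); [|rewrite F by (right; lia); easy..].
  apply (ready_frame s); [easy|].
  apply (frame_trans 9 15 s s); [lia|apply frame_refl|easy].
Qed.

Lemma frame_weaken lo lo' s s' : lo <= lo' -> frame lo' s s' -> frame lo s s'.
Proof. intros Hl F. apply (frame_trans lo lo' s s); auto using frame_refl. Qed.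

Definition literal_time : nat := S (cost (var 18) + time scan_literal).

Lemma scan_literals_run C : forall s P g al rest b,
  scanning s P g al -> skipn (s 2 17) input = map encode_literal C ++ rest ->
  (forall l, In l C -> fst l < m) ->
  s 2 18 = length C -> length C < B -> s 2 19 = Nat.b2n b ->
  runs B (While (var 18) scan_literal) s (length C * literal_time + S (cost (var 18)))
    (fun s' => frame 17 s s' /\ skipn (s' 2 17) input = rest /\
               s' 2 19 = Nat.b2n (b && forallb (literal_false k q a P g al) C)).
Proof.
  induction C as [|l C IH]; intros s P g al rest b Hscan Hskip HC Hlen HB Hb.
  - apply runs_while_false.
    + apply eval_var; [unfold constants_bound in hB|easy|]; lia.
    + split; [apply frame_refl|]. split; [easy|]. now rewrite andb_true_r.
  - cbn [map app length] in *.
    apply runs_weaken with (t := S (cost (var 18) + time scan_literal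
       + (length C * literal_time + S (cost (var 18)))))
      (Q := fun s' => frame 17 s s' /\ skipn (s' 2 17) input = rest /\
               s' 2 19 = Nat.b2n (b && forallb (literal_false k q a P g al) (l :: C)));
      [|unfold literal_time; lia|easy].
    apply runs_while_true with (v := S (length C)); [|easy|].
    + apply eval_var; [unfold constants_bound in hB|easy|]; lia.
    + eapply runs_weaken; [eapply (scan_literal_runs s P g al l); eauto|easy|].
      { apply HC. now left. }
      intros s' (F & E1 & E2 & E3).
      destruct (skipn_cons _ _ _ _ 0 Hskip) as (_ & _ & Hskip').
      rewrite <- E1 in Hskip'.
      eapply runs_weaken; [eapply (IH s' P g al rest)|easy|].
      * apply (scanning_frame s); [easy|]. apply (frame_weaken 15 17); [lia|easy].
      * exact Hskip'.
      * intros l' Hl'. apply HC. now right.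
      * rewrite E2. apply Nat.sub_0_r.
      * lia.
      * exact E3.
      * intros s'' (F' & H1 & H2). split; [|split; [easy|]].
        -- now apply (frame_trans 17 17 s s').
        -- rewrite H2. cbn [forallb]. now rewrite andb_assoc.
Qed.

Definition clause_time : nat :=
  S (cost (var 16) + S (time clause_head
     + S ((k * literal_time + S (cost (var 18))) + time clause_tail))).

Lemma scan_clauses_run Cs : forall s P g al b,
  scanning s P g al ->
  skipn (s 2 17) input = flat_map (fun C => length C :: map encode_literal C) Cs ->
  (forall C, In C Cs -> length C <= k /\ forall l, In l C -> fst l < m) ->
  s 2 16 = length Cs -> length Cs < B -> s 2 15 = Nat.b2n b ->
  runs B (While (var 16) scan_clause) s (length Cs * clause_time + S (cost (var 16)))
    (fun s' => frame 15 s s' /\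
       s' 2 15 = Nat.b2n (b && negb (existsb
         (fun C => forallb (literal_false k q a P g al) C) Cs))).
Proof.
  induction Cs as [|C Cs IH]; intros s P g al b Hscan Hskip HCs Hlen HB Hb.
  - apply runs_while_false.
    + apply eval_var; [unfold constants_bound in hB|easy|]; lia.
    + split; [apply frame_refl|]. simpl. now rewrite andb_true_r.
  - cbn [flat_map length] in *.
    set (post := fun s' => frame 15 s s' /\
       s' 2 15 = Nat.b2n (b && negb (existsb
         (fun C => forallb (literal_false k q a P g al) C) (C :: Cs)))).
    apply runs_weaken with (t := clause_time + (length Cs * clause_time + S (cost (var 16))))
      (Q := post); [|lia|easy].
    unfold clause_time at 1. cbn [Nat.add].
    apply runs_while_true with (v := S (length Cs)); [|easy|].
    { apply eval_var; [unfold constants_bound in hB|easy|]; lia. }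
    destruct (HCs C (or_introl eq_refl)) as [HCk HCm].
    destruct (skipn_cons _ _ _ _ 0 Hskip) as (Hptr & Hnth & Hskip').
    assert (Hread : s 0 (s 2 17) = length C) by (rewrite <- Hnth; apply Hscan).
    assert (HCB : length C < B).
    { eapply Nat.le_lt_trans; [exact HCk|]. unfold constants_bound in hB. lia. }
    unfold scan_clause. apply runs_seq.
    apply runs_weaken with (t := time clause_head) (Q := fun s1 =>
      frame 17 s s1 /\ s1 2 17 = S (s 2 17) /\ s1 2 18 = length C /\ s1 2 19 = 1);
      [|easy|].
    { set (ptr := s 2 17) in *. assert (Hp : s 2 17 = ptr) by reflexivity. clearbody ptr.
      unfold constants_bound in hB. unfold clause_head.
      step_set (length C). step_set (S ptr). step_set 1.
      split; [repeat (apply frame_write; [|lia]); apply frame_refl|]. repeat split. }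
    intros s1 (F1 & E17 & E18 & E19).
    apply runs_seq.
    apply runs_weaken with (t := length C * literal_time + S (cost (var 18)))
      (Q := fun s2 => frame 17 s1 s2 /\
         skipn (s2 2 17) input = flat_map (fun C => length C :: map encode_literal C) Cs /\
         s2 2 19 = Nat.b2n (true && forallb (literal_false k q a P g al) C)).
    { apply scan_literals_run; auto.
      - apply (scanning_frame s); [easy|]. apply (frame_weaken 15 17); [lia|easy].
      - now rewrite E17. }
    { apply Nat.add_le_mono_r, Nat.mul_le_mono_r, HCk. }
    intros s2 (F2 & Hskip2 & E19').
    cbn [andb] in E19'. set (cf := forallb _ C) in *.
    assert (F02 : frame 17 s s2) by (apply (frame_trans 17 17 s s1); auto).
    assert (G15 : s2 2 15 = Nat.b2n b) by (rewrite F02; [easy|right; lia]).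
    assert (G16 : s2 2 16 = S (length Cs)) by (rewrite F02; [easy|right; lia]).
    apply runs_weaken with (t := time clause_tail) (Q := fun s3 =>
      frame 15 s2 s3 /\ s3 2 17 = s2 2 17 /\ s3 2 15 = Nat.b2n (b && negb cf) /\
      s3 2 16 = length Cs); [|easy|].
    { pose proof (b2n_bound b). pose proof (b2n_bound cf). unfold constants_bound in hB.
      unfold clause_tail. apply runs_seq_time.
      apply runs_set with (v := Nat.b2n (b && negb cf)); [lia| |].
      - eapply eval_conv;
          [ev; first [lia|eapply Nat.le_lt_trans; [apply b2n_product_le|lia]]|].
        rewrite <- b2n_mul. now destruct cf.
      - step_set (length Cs).
        split; [repeat (apply frame_write; [|lia]); apply frame_refl|]. repeat split. }
    intros s3 (F3 & H17 & H15 & H16).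
    assert (F03 : frame 15 s s3)
      by (apply (frame_trans 15 15 s s2); auto; apply (frame_weaken 15 17); auto; lia).
    eapply runs_weaken; [apply (IH s3 P g al (b && negb cf))|easy|].
    + now apply (scanning_frame s).
    + now rewrite H17.
    + intros C' HC'. apply HCs. now right.
    + easy.
    + lia.
    + easy.
    + intros s4 (F4 & H4). split; [now apply (frame_trans 15 15 s s3)|].
      rewrite H4. cbn [existsb]. fold cf. now rewrite negb_orb, andb_assoc.
Qed.

(** * Verification of the weights and of one operation *)

Lemma eval_blk s g l :
  s 2 12 = g -> g < B -> l < k -> eval B s (blk_expr l) = Some (blk q g l).
Proof.
  intros Hg HgB Hl. unfold constants_bound in hB.
  assert (Hpow : q ^ l <= q ^ k) by (apply Nat.pow_le_mono_r; lia).
  unfold blk_expr. eapply eval_conv; [ev; lia|reflexivity].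
Qed.

Lemma eval_slot s al l :
  s 2 0 = a -> s 2 4 = 2 ^ a -> s 2 13 = al -> al < B -> l < k ->
  eval B s (slot_expr l) = Some (slot a al l).
Proof.
  intros H0 H4 Hal HalB Hl. unfold constants_bound in hB.
  assert (Hka : k * a <= log_ops) by (unfold log_ops; lia).
  assert (Hal' : a * l <= k * a) by (rewrite Nat.mul_comm; apply Nat.mul_le_mono_r; lia).
  assert (Ha : a <= q * a) by (apply le_mul_pos; exact hq).
  assert (Hpow : 2 ^ a <= 2 ^ log_ops).
  { apply pow_le_ops. eapply Nat.le_trans; [apply le_mul_pos, hk|exact Hka]. }
  unfold slot_expr. eapply eval_conv; [ev; lia|reflexivity].
Qed.

Lemma weight_runs s g al :
  ready s -> s 2 12 = g -> s 2 13 = al -> g < groups k q -> al < B ->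
  runs B weight_cmd s (time weight_cmd) (fun s' =>
    frame 23 s s' /\ s' 2 23 = weight k q a r0 gam g al).
Proof.
  intros (Hin & H0 & H1 & H2 & H3 & H4 & H5 & H6 & H7 & H8) Hg Hal Hgg HalB.
  pose proof tmax_le as Ht.
  (* Intermediate values are bounded by the weight, by [2 ^ shift] or by a constant, hence fit in a
     word. *)
  assert (Hw : weight k q a r0 gam g al < 2 ^ log_tmax).
  { eapply Nat.lt_le_trans; [apply weight_lt; eauto|].
    apply Nat.pow_le_mono_r; [easy|]. unfold log_tmax. lia. }
  assert (Hshift : q * db + (2 * a + r0) <= shift) by reflexivity.
  assert (Hsh' : 2 ^ shift <= 2 ^ log_tmax)
    by (apply Nat.pow_le_mono_r; [easy|unfold log_tmax; lia]).
  assert (Hsh : shift < 2 ^ shift) by (apply Nat.pow_gt_lin_r; lia).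
  assert (HA : 2 ^ a * 2 ^ a <= 2 ^ shift).
  { rewrite <- Nat.pow_add_r. apply Nat.pow_le_mono_r; lia. }
  assert (HA' := le_mul_pow2 (2 ^ a) a).
  assert (Hdbq : db * q <= shift) by lia.
  assert (Hdbb : forall l, db * blk q g l <= shift).
  { intros l. eapply Nat.le_trans; [|exact Hdbq].
    apply Nat.mul_le_mono_l, Nat.lt_le_incl, blk_lt, hq. }
  assert (Hdb : db <= q * db) by (apply le_mul_pos; exact hq).
  unfold weight in Hw.
  set (top := (2 ^ (gam * groups k q) + 2 ^ (gam * g)) * 2 ^ shift) in Hw.
  unfold constants_bound in hB.
  assert (HgB : g < B) by lia.
  unfold weight_cmd. apply runs_seq_time.
  apply runs_weaken with (t := time low_cmd)
    (Q := fun s1 => s1 = write s 2 23 (low k q a r0 g al)); [|easy|].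
  - eapply runs_if; [ev; lia| |]; intros Hcond.
    + assert (E : (g <? q ^ k) = true) by now destruct (g <? q ^ k).
      unfold low in *. rewrite E in *.
      eapply runs_set; [lia| |reflexivity].
      apply eval_sum; [lia|]. intros l Hl.
      assert (Hterm := sum_term_le k (fun l => slot a al l * 2 ^ (db * blk q g l)
                    + slot a al l * slot a al l * 2 ^ (db * q)) l Hl).
      cbv beta in Hterm.
      assert (Hsq := le_mul_pow2 (slot a al l * slot a al l) (db * q)).
      specialize (Hdbb l).
      assert (Hslot := eval_slot s al l H0 H4 Hal HalB Hl).
      assert (Hblk := eval_blk s g l Hg HgB Hl).
      apply eval_add; [apply eval_shl; [exact Hslot|apply eval_mul; [ev|exact Hblk|]|]
        |apply eval_shl; [apply eval_mul; [exact Hslot|exact Hslot|]|ev|]|]; lia.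
    + assert (E : (g <? q ^ k) = false) by now destruct (g <? q ^ k).
      unfold low in *. rewrite E in *.
      eapply runs_set; [lia| |reflexivity].
      assert (Hslot := eval_slot s al 0 H0 H4 Hal HalB hk).
      assert (Hblk := eval_blk s g 0 Hg HgB hk).
      specialize (Hdbb 0).
      assert (Hx := le_mul_pow2 (degree k q * (2 ^ a - slot a al 0)) (db * blk q g 0)).
      assert (Hy := le_mul_pow2 (degree k q * (2 ^ a * 2 ^ a - slot a al 0 * slot a al 0)) (db * q)).
      assert (Hss : slot a al 0 * slot a al 0 <= 2 ^ a * 2 ^ a)
        by (apply Nat.mul_le_mono; apply Nat.lt_le_incl, slot_lt).
      match type of Hw with ?x + ?y + top < _ =>
        assert (Hlow : x + y < B) by (clear - Hw Ht hB; lia);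
        assert (Hx' : x < B) by exact (Nat.le_lt_trans _ _ _ (Nat.le_add_r x y) Hlow);
        assert (Hy' : y < B) by exact (Nat.le_lt_trans _ _ _ (Nat.le_add_l y x) Hlow)
      end.
      assert (Hx'' := Nat.le_lt_trans _ _ _ Hx Hx').
      assert (Hy'' := Nat.le_lt_trans _ _ _ Hy Hy').
      apply eval_add.
      * apply eval_shl; [apply eval_mul; [ev|apply eval_sub; [ev|exact Hslot]|]
          |apply eval_mul; [ev|exact Hblk|]|]; first [assumption|lia].
      * apply eval_shl; [apply eval_mul; [ev|apply eval_sub; [ev|apply eval_mul;
          [exact Hslot|exact Hslot|]]|]|ev|]; first [assumption|lia].
      * assumption.
  - intros s1 ->.
    assert (Hgam : 2 ^ (gam * g) <= 2 ^ (gam * groups k q)).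
    { apply Nat.pow_le_mono_r; [easy|]. apply Nat.mul_le_mono_l. lia. }
    assert (Hgam' : gam * g <= gam * S (groups k q)) by (apply Nat.mul_le_mono_l; lia).
    apply runs_set with (v := weight k q a r0 gam g al); [lia| |].
    + unfold weight. fold top. eapply eval_conv; [ev; rewrite ?Nat.mul_1_l; fold top; lia|].
      rewrite Nat.mul_1_l. reflexivity.
    + split; [repeat (apply frame_write; [|lia]); apply frame_refl|reflexivity].
Qed.

Lemma operand_lt P h u : operand (phase_op k q a r0 gam phi P h u) < 2 ^ log_tmax.
Proof.
  unfold phase_op. pose proof target_lt.
  assert (Hw : item_ok k q a phi P (u / 2 ^ (k * a)) (u mod 2 ^ (k * a)) = true ->
    weight k q a r0 gam (u / 2 ^ (k * a)) (u mod 2 ^ (k * a)) < 2 ^ log_tmax).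
  { intros Hok. apply andb_true_iff in Hok. destruct Hok as [Hg _]. apply Nat.ltb_lt in Hg.
    eapply Nat.lt_le_trans; [apply weight_lt; eauto|].
    apply Nat.pow_le_mono_r; [easy|]. unfold log_tmax. clear. lia. }
  destruct (item_ok _ _ _ _ _ _ _); [specialize (Hw eq_refl)|];
    destruct (h =? 0), (h =? 2); assumption.
Qed.

(** The two writes to array 3 are exactly [receive] on the hosted memory, whatever that memory
    is. *)
Lemma choose_op_runs s P h u :
  ready s -> s 2 11 = h -> h < 4 -> s 2 12 = u / 2 ^ (k * a) -> s 2 13 = u mod 2 ^ (k * a) ->
  u < B -> s 2 15 = Nat.b2n (item_ok k q a phi P (u / 2 ^ (k * a)) (u mod 2 ^ (k * a))) ->
  runs B choose_op s (time choose_op) (fun s' =>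
    let o := phase_op k q a r0 gam phi P h u in
    (forall b i, b < 3 -> b <> 2 \/ i < 22 -> s' b i = s b i) /\
    s' 2 22 = opcode o /\ forall sp, hosts 3 sp s -> hosts 3 (receive o sp) s').
Proof.
  intros Hready Hh Hh4 Hg Hal HuB Hok.
  set (o := phase_op k q a r0 gam phi P h u).
  pose proof (operand_lt P h u) as Hop. fold o in Hop. pose proof tmax_le as Ht.
  pose proof hB as hB'. unfold constants_bound in hB'.
  assert (HB : operand o < B) by lia.
  assert (Hoc : opcode o < B) by (destruct o; simpl; lia).
  set (okb := item_ok _ _ _ _ _ _ _) in Hok.
  pose proof (b2n_bound okb). pose proof (b2n_bound (h =? 0)). pose proof (b2n_bound (h =? 2)).
  unfold choose_op. apply runs_seq_time.
  apply runs_weaken with (t := time (If (var 15 * ((var 11 == #0) + (var 11 == #2)))%E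
      (set 22 (var 11 == #2)%E;; weight_cmd) (set 22 #2%E;; set 23 (var 8))))
    (Q := fun s1 => frame 22 s s1 /\ s1 2 22 = opcode o /\ s1 2 23 = operand o);
    [|easy|].
  - assert (Hsel : Nat.b2n okb * (Nat.b2n (h =? 0) + Nat.b2n (h =? 2))
                   = Nat.b2n (okb && ((h =? 0) || (h =? 2)))).
    { destruct okb, (Nat.eqb_spec h 0), (Nat.eqb_spec h 2); try reflexivity; lia. }
    eapply runs_if with (v := Nat.b2n (okb && ((h =? 0) || (h =? 2)))).
    { eapply eval_conv; [ev; rewrite ?Hsel|exact Hsel];
        pose proof (b2n_bound (okb && ((h =? 0) || (h =? 2)))); lia. }
    + intros Hc. destruct okb eqn:Eok; [|easy].
      assert (Ho : o = if h =? 0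
        then Insert (weight k q a r0 gam (u / 2 ^ (k * a)) (u mod 2 ^ (k * a)))
        else Delete (weight k q a r0 gam (u / 2 ^ (k * a)) (u mod 2 ^ (k * a)))).
      { unfold o, phase_op. fold okb. rewrite Eok.
        destruct (Nat.eqb_spec h 0), (Nat.eqb_spec h 2); easy. }
      apply runs_seq_time. apply runs_set with (v := opcode o); [lia| |].
      { eapply eval_conv; [ev; lia|]. rewrite Ho.
        destruct (Nat.eqb_spec h 0), (Nat.eqb_spec h 2); try easy; lia. }
      eapply runs_weaken; [eapply (weight_runs _ (u / 2 ^ (k * a)) (u mod 2 ^ (k * a)))|easy|].
      * eapply ready_frame; [exact Hready|]. apply frame_write; [apply frame_refl|lia].
      * rd. exact Hg.
      * rd. exact Hal.
      * apply andb_true_iff in Eok. now apply Nat.ltb_lt.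
      * eapply Nat.le_lt_trans; [apply Nat.Div0.mod_le|exact HuB].
      * intros s1 [F E]. split; [|split].
        -- apply (frame_trans 22 23 s (write s 2 22 (opcode o)) s1); [lia| |exact F].
           apply frame_write; [apply frame_refl|lia].
        -- rewrite F by (right; lia). reflexivity.
        -- rewrite E, Ho. now destruct (h =? 0).
    + intros Hc.
      assert (Ho : o = Query target).
      { unfold o, phase_op. fold okb.
        destruct okb, (Nat.eqb_spec h 0), (Nat.eqb_spec h 2); easy. }
      rewrite Ho in *. cbn [opcode operand] in *.
      destruct Hready as (_ & _ & _ & _ & _ & _ & _ & _ & _ & H8).
      step_set 2. step_set (target).
      split; [|split; reflexivity].
      repeat (apply frame_write; [|lia]). apply frame_refl.
  - intros s1 (F & E1 & E2).
    apply runs_seq_time. apply runs_assign with (j := 0) (v := opcode o).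
    { ev. lia. }
    { ev; lia. }
    eapply runs_assign with (j := 1) (v := operand o).
    { ev. lia. }
    { ev; lia. }
    split; [|split].
    + intros b i Hb Hi. rd. replace (b =? 3) with false by (symmetry; apply Nat.eqb_neq; lia).
      cbn [andb]. now apply F.
    + rd. exact E1.
    + intros sp Hsp b i. unfold receive. rd. cbn [Nat.add Nat.eqb].
      rewrite F by (left; lia). change (S (S (S b))) with (3 + b). now rewrite Hsp.
Qed.

Lemma collect_runs s o j :
  s 2 22 = opcode o -> s 2 9 = j -> j < 2 ^ log_ops -> s 4 0 < B ->
  runs B collect s (time collect) (fun s' =>
    (forall b i, b <> 1 -> b <> 2 \/ i < 9 -> s' b i = s b i) /\ s' 2 9 = S j /\
    (s' 1 0 <> 0 <-> s 1 0 <> 0 \/ (opcode o = 2 /\ s 4 0 <> 0))).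
Proof.
  intros Hoc Hj Hlt H4. unfold constants_bound in hB.
  set (v := s 4 0) in *. assert (Hv : s 4 0 = v) by reflexivity. clearbody v.
  assert (Hoc2 : opcode o <= 2) by (destruct o; simpl; lia).
  unfold collect. apply runs_seq_time.
  apply runs_weaken with (t := time (If (var 22 == #2)%E
      (If (Cell 4 #0%E) (Assign 1 #0%E #1%E) Skip) Skip))
    (Q := fun s1 => (forall b i, b <> 1 -> s1 b i = s b i) /\
      (s1 1 0 <> 0 <-> s 1 0 <> 0 \/ (opcode o = 2 /\ v <> 0))); [|easy|].
  - eapply runs_if; [ev; lia| |]; intros Hc.
    + assert (E : opcode o = 2) by (now destruct (Nat.eqb_spec (opcode o) 2)).
      eapply runs_if; [ev; lia| |]; intros Hc'.
      * eapply runs_assign; [ev; lia|ev; lia|]. split.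
        -- intros b i Hb. unfold write. now rewrite (proj2 (Nat.eqb_neq b 1)).
        -- rd. split; [now right|easy].
      * apply runs_skip. split; [easy|]. tauto.
    + assert (E : opcode o <> 2) by (now destruct (Nat.eqb_spec (opcode o) 2)).
      apply runs_skip. split; [easy|]. tauto.
  - intros s1 (F & E). assert (Hj1 : s1 2 9 = j) by now rewrite F.
    step_set (S j). split; [|split].
    + intros b i Hb Hi. unfold write.
      destruct (Nat.eqb_spec b 2), (Nat.eqb_spec i 9); cbn [andb]; try lia; now apply F.
    + reflexivity.
    + exact E.
Qed.

(** * The main loop *)

Definition step_time : nat :=
  time decode + (length phi * clause_time + S (cost (var 16)))
  + time choose_op + time collect + 10.

Variable Bp : nat.
Hypothesis hBp : Bp <= B.

(** Each turn of the loop replays one step of the derivation of [serves] on the hosted memory, so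
    the total time is [T] plus a fixed overhead per operation. *)
Lemma program_loop n : forall j s S M T,
  serves Bp p M s (map (fun j => op j) (seq j n)) T ->
  ready S -> S 2 9 = j -> j + n = 2 ^ log_ops -> hosts 3 s S ->
  (forall b i, s b i < B) ->
  runs B (While (var 9 < var 7)%E step) S (T + n * step_time + 10) (fun S' =>
    S' 1 0 <> 0 <-> S 1 0 <> 0 \/ hits M (map (fun j => op j) (seq j n))).
Proof.
  induction n as [|n IH]; intros j s S0 M T Hserves Hready Hj Hjn Hhosts Hbound.
  - assert (H7 : S0 2 7 = 2 ^ log_ops) by apply Hready.
    apply runs_weaken with (t := S (cost (var 9 < var 7)%E)) (Q := fun S' => S' = S0).
    + apply runs_while_false; [|easy]. unfold constants_bound in hB.
      eapply eval_conv; [ev; lia|].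
      destruct (Nat.ltb_spec j (2 ^ log_ops)); [lia|easy].
    + simpl. lia.
    + intros S' ->. simpl. tauto.
  - assert (H7 : S0 2 7 = 2 ^ log_ops) by apply Hready.
    cbn [seq map] in *. inversion Hserves as [|M0 s0 o ops s' T1 T2 Hexec Hans Hrest]; subst.
    set (j := S0 2 9) in *. assert (Hj : S0 2 9 = j) by reflexivity. clearbody j.
    set (post := fun S' : memory => S' 1 0 <> 0 <-> S0 1 0 <> 0 \/ hits M (op j :: map (fun j => op j) (seq (S j) n))).
    assert (Hlt : j < 2 ^ log_ops) by lia.
    set (u := j mod 2 ^ (gam + k * a)).
    assert (Hu : u <= j) by apply Nat.Div0.mod_le.
    assert (HjB : j < B) by (unfold constants_bound in hB; lia).
    set (okb := item_ok k q a phi (prefix_at j) (u / 2 ^ (k * a)) (u mod 2 ^ (k * a))).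
    apply runs_weaken with (Q := post) (t :=
      S (cost (var 9 < var 7)%E
         + S (time decode + S ((length phi * clause_time + S (cost (var 16)))
              + S (time choose_op + S (T1 + time collect))))
         + (T2 + n * step_time + 10))); [|unfold step_time; simpl; lia|easy].
    apply runs_while_true with (v := 1); [|easy|].
    { unfold constants_bound in hB. eapply eval_conv; [ev; lia|].
      destruct (Nat.ltb_spec j (2 ^ log_ops)); [easy|lia]. }
    unfold step. apply runs_seq.
    eapply runs_weaken; [now apply (decode_runs S0 j)|easy|].
    intros S1 (F1 & D10 & D11 & D12 & D13 & D15 & D16 & D17).
    assert (R1 : ready S1).
    { apply (ready_frame S0); [easy|]. apply (frame_weaken 9 10); [lia|easy]. }
    apply runs_seq.
    apply runs_weaken with (t := length phi * clause_time + S (cost (var 16)))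
      (Q := fun S2 => frame 15 S1 S2 /\ S2 2 15 = Nat.b2n okb); [|easy|].
    { assert (HPB : prefix_at j <= j) by (eapply Nat.le_trans; [apply div_le|apply div_le]).
      assert (HgB : group_at j <= u) by apply div_le.
      assert (HalB : slots_at j <= u) by apply Nat.Div0.mod_le.
      eapply runs_weaken; [eapply (scan_clauses_run phi S1 (prefix_at j) (group_at j) (slots_at j))|easy|].
      - repeat split; try apply R1; auto; lia.
      - rewrite D17. reflexivity.
      - apply hphi.
      - easy.
      - eapply Nat.le_lt_trans; [exact length_phi_le|]. lia.
      - exact D15.
      - intros S2 H2. exact H2. }
    intros S2 (F2 & E15).
    assert (G : forall i, i < 15 -> S2 2 i = S1 2 i) by (intros; apply F2; now right).
    assert (R2 : ready S2).
    { apply (ready_frame S1); [easy|]. apply (frame_weaken 9 15); [lia|easy]. }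
    apply runs_seq.
    eapply runs_weaken; [apply (choose_op_runs S2 (prefix_at j) (phase_at j) u)|easy|].
    { exact R2. }
    { rewrite G by lia. exact D11. }
    { apply Nat.mod_upper_bound. easy. }
    { rewrite G by lia. exact D12. }
    { rewrite G by lia. exact D13. }
    { lia. }
    { exact E15. }
    change (phase_op k q a r0 gam phi (prefix_at j) (phase_at j) u) with (op j).
    cbv zeta. intros S3 (F3 & E22 & H3).
    assert (Hh2 : hosts 3 s S2).
    { intros b i. rewrite F2, F1 by (left; lia). apply Hhosts. }
    specialize (H3 s Hh2).
    apply runs_seq.
    destruct (exec_shift 3 Bp B p _ _ _ hBp Hexec S3 H3) as (S4 & X4 & H4 & F4).
    exists T1, S4. split; [exact X4|]. split; [easy|].
    assert (Hbound' : forall b i, s' b i < B).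
    { apply (exec_bounded Bp B p _ _ _ hBp Hexec). intros b i.
      pose proof (operand_lt (prefix_at j) (phase_at j) u) as Hop.
      change (phase_op k q a r0 gam phi (prefix_at j) (phase_at j) u) with (op j) in Hop.
      pose proof tmax_le. unfold constants_bound in hB.
      unfold receive, write.
      destruct ((b =? 0) && (i =? 1))%bool; [lia|].
      destruct ((b =? 0) && (i =? 0))%bool; [|apply Hbound].
      destruct (op j); simpl; lia. }
    assert (E40 : S4 4 0 = s' 1 0) by apply (H4 1 0).
    eapply runs_weaken; [apply (collect_runs S4 (op j) j)|easy|].
    { rewrite F4 by lia. exact E22. }
    { rewrite F4, F3, G, F1 by lia. exact Hj. }
    { exact Hlt. }
    { rewrite E40. apply Hbound'. }
    intros S5 (F5 & E9 & E10).
    assert (R5 : ready S5).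
    { apply (ready_cells S2); [exact R2| |].
      - intros i. rewrite F5, F4, F3 by lia. easy.
      - intros i Hi. rewrite F5, F4, F3 by lia. easy. }
    eapply runs_weaken; [apply (IH (S j) s' S5 (update (op j) M) T2)|easy|].
    + exact Hrest.
    + exact R5.
    + exact E9.
    + lia.
    + intros b i. rewrite F5 by lia. apply H4.
    + exact Hbound'.
    + intros S' HS'. unfold post. rewrite HS', E10.
      rewrite F4, F3, F2, F1 by lia. rewrite E40. cbn [hits].
      assert (Hq : (opcode (op j) = 2 /\ s' 1 0 <> 0) <->
        match op j with Query t => subset_sum M t | _ => False end).
      { unfold answers, accepts in Hans. clear - Hans.
        destruct (op j); cbn [opcode]; [split; [intros [H _]; discriminate H|easy]..|].
        rewrite <- Hans. tauto. }
      rewrite Hq. clear. tauto.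
Qed.

Lemma op_sequence_eq :
  op_sequence k q a r0 gam phi prefix_bits = map (fun j => op j) (seq 0 (2 ^ log_ops)).
Proof.
  unfold op_sequence. do 2 f_equal. unfold log_ops, prefix_bits.
  change 4 with (2 ^ 2). rewrite <- !Nat.pow_add_r. f_equal. clear. lia.
Qed.

Lemma sat_program_runs T :
  serves Bp p [] (input_memory [0; 0; 2 ^ log_tmax; S log_ops])
    (op_sequence k q a r0 gam phi prefix_bits) T ->
  runs B sat_program (input_memory input)
    (S (time init + (T + 2 ^ log_ops * step_time + 10)))
    (fun s => accepts s <-> satisfiable phi).
Proof.
  intros Hserves.
  assert (Hops := op_sequence_eq).
  unfold sat_program. apply runs_seq.
  eapply runs_weaken; [apply init_runs|easy|].
  intros s1 (Hready & H9 & H10 & Hhosts).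
  rewrite Hops in Hserves.
  eapply runs_weaken;
    [apply (program_loop (2 ^ log_ops) 0 _ s1 _ _ Hserves Hready H9 (Nat.add_0_l _) Hhosts)|easy|].
  - pose proof tmax_le. unfold constants_bound in hB.
    intros [|b] i; unfold input_memory; cbn [Nat.eqb]; [|lia].
    destruct i as [|[|[|[|i]]]]; cbn [nth]; try lia. destruct i; lia.
  - intros s2 Hs2. unfold accepts. rewrite Hs2, H10, <- Hops.
    destruct (op_sequence_correct k q a r0 gam phi m (2 ^ log_tmax) hk hq hgam hr0 hphi)
      with (p1 := prefix_bits) as [_ Hhits]; [apply Nat.lt_le_incl, target_lt|exact hqa|unfold prefix_bits; lia|].
    rewrite <- Hhits. split; [now intros [H|H]|now right].
Qed.

(** By [hlog], [tmax] is at most the number of operations, and all operands are smaller than [tmax];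
    so the number of operations determines the word length. *)
Lemma word_length_ops :
  word_length (2 ^ log_tmax) (op_sequence k q a r0 gam phi prefix_bits) = S log_ops.
Proof.
  unfold word_length. f_equal.
  set (ops := op_sequence _ _ _ _ _ _ _).
  assert (Hlen : length ops = 2 ^ log_ops).
  { unfold ops. now rewrite op_sequence_eq, length_map, length_seq. }
  replace (list_max _) with (2 ^ log_ops); [now apply Nat.log2_pow2, Nat.le_0_l|].
  pose proof tmax_le as Ht. apply Nat.le_antisymm.
  - rewrite <- Hlen. cbn [list_max fold_right]. clear. lia.
  - apply list_max_le. constructor; [easy|]. constructor; [now rewrite Hlen|].
    apply Forall_forall. intros x Hx. apply in_map_iff in Hx. destruct Hx as (o & <- & Ho).
    unfold ops, op_sequence in Ho. apply in_map_iff in Ho. destruct Ho as (j & <- & _).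
    eapply Nat.le_trans; [apply Nat.lt_le_incl, operand_lt|exact Ht].
Qed.

End Program.

(** * Choice of the constants *)

Fixpoint all_clauses (m k : nat) : list clause :=
  match k with
  | 0 => [[]]
  | S k' => [] :: flat_map (fun C => map (fun l => l :: C)
              (list_prod (seq 0 m) [true; false])) (all_clauses m k')
  end.

Lemma all_clauses_complete m k : forall C : clause,
  length C <= k -> (forall l, In l C -> fst l < m) -> In C (all_clauses m k).
Proof.
  induction k as [|k IH]; intros C HC Hm.
  - destruct C; [now left|simpl in HC; lia].
  - destruct C as [|[v b] C]; [now left|right].
    apply in_flat_map. exists C. split.
    + apply IH; [simpl in HC; lia|]. intros l Hl. apply Hm. now right.
    + apply (in_map (fun l => l :: C)), in_prod.
      * apply in_seq. specialize (Hm (v, b) (or_introl eq_refl)). simpl in Hm. lia.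
      * destruct b; simpl; auto.
Qed.

Lemma length_all_clauses m k : length (all_clauses m k) <= (2 * m + 1) ^ k.
Proof.
  induction k as [|k IH]; [easy|].
  cbn [all_clauses length]. rewrite Nat.pow_succ_r'.
  rewrite (flat_map_constant_length (c := 2 * m)).
  - assert ((2 * m + 1) ^ k <> 0) by (apply Nat.pow_nonzero; lia).
    apply (Nat.mul_le_mono_r _ _ (2 * m)) in IH.
    change (list (nat * bool)) with clause. lia.
  - intros C _. rewrite length_map, length_prod, length_seq. simpl. lia.
Qed.

Lemma length_kcnf k m phi : is_kcnf k m phi -> length phi <= (2 * m + 1) ^ k.
Proof.
  intros [Hnd HC]. eapply Nat.le_trans; [|apply length_all_clauses].
  apply NoDup_incl_length; [easy|]. intros C H. apply all_clauses_complete; now apply HC.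
Qed.

Lemma length_encode_cnf k m phi :
  is_kcnf k m phi -> length (encode_cnf m phi) <= 2 + (2 * m + 1) ^ k * S k.
Proof.
  intros Hphi. apply Nat.le_trans with (2 + length phi * S k).
  - unfold encode_cnf. cbn [length]. do 2 apply le_n_S.
    assert (H : forall C, In C phi -> length C <= k) by (intros; now apply Hphi).
    clear Hphi. induction phi as [|C phi IH]; [easy|].
    cbn [flat_map length]. rewrite length_app. cbn [length]. rewrite length_map.
    assert (length C <= k) by (apply H; now left).
    specialize (IH (fun C HC => H C (or_intror HC))).
    cbn [Nat.mul]. apply Nat.add_le_mono; [now apply le_n_S|exact IH].
  - apply Nat.add_le_mono_l, Nat.mul_le_mono_r. now apply length_kcnf.
Qed.

(** From [n < 2 ^ n] at [n = a / k] one gets [a + 1 <= k * 2 ^ (a / k)], to be raised to the power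
    [k]. This charges the clause tests to a factor [2 ^ a]. *)
Lemma pow_le_exponential k a : 1 <= k -> (a + 1) ^ k <= k ^ k * 2 ^ a.
Proof.
  intros Hk.
  assert (H1 : a + 1 <= k * 2 ^ (a / k)).
  { assert (a / k < 2 ^ (a / k)) by (apply Nat.pow_gt_lin_r; lia).
    pose proof (Nat.div_mod_eq a k). pose proof (Nat.mod_upper_bound a k ltac:(lia)). nia. }
  eapply Nat.le_trans; [apply Nat.pow_le_mono_l, H1|].
  rewrite Nat.pow_mul_l, <- Nat.pow_mul_r. apply Nat.mul_le_mono_l, Nat.pow_le_mono_r; [easy|].
  rewrite Nat.mul_comm. apply Nat.Div0.mul_div_le.
Qed.

Section Constants.

Variables (k q C n0 tau b : nat).
Hypothesis hk : 1 <= k.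
Hypothesis hq : 2 <= q.
Hypothesis hC : 1 <= C.

(** For [q >= 2], [3 C q] is at least [q + C (q + 2)]; so the [m - q a] prefix variables alone
    account for [C (q + 2) a] bits of the number of operations. *)
Definition shrink : nat := 3 * C * q.
(** This and [carry_bits] meet the hypotheses on [gam] and [r0] by [n < 2 ^ n]; being constants,
    they need not be tight. *)
Definition select_bits : nat := groups k q.
Definition carry_bits : nat := groups k q * degree k q.
Definition tmax_const : nat :=
  (q + 1) * carry_bits + (select_bits * S (groups k q) + tau).
(** These extra prefix bits make up for the constant part of [log_tmax], [C] times, and for the
    constant factor of the required number of operations. *)
Definition padding : nat := C * tmax_const + n0.

Notation a m := (block_size shrink m).
Notation lops m := (log_ops k q select_bits shrink padding m).
Notation ltmax m := (log_tmax k q carry_bits select_bits shrink tau m).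

Lemma shrink_blocks m : shrink * a m <= m.
Proof. apply Nat.Div0.mul_div_le. Qed.

Lemma shrink_ge : q + C * (q + 2) <= shrink.
Proof. unfold shrink. clear - hq hC. nia. Qed.

Lemma blocks_le m : q * a m + C * ((q + 2) * a m) <= m.
Proof.
  eapply Nat.le_trans; [|apply shrink_blocks].
  rewrite Nat.mul_assoc, <- Nat.mul_add_distr_r. apply Nat.mul_le_mono_r, shrink_ge.
Qed.

Lemma log_tmax_eq m : ltmax m = (q + 2) * a m + tmax_const.
Proof. unfold log_tmax, select_shift, digit_bits, tmax_const. ring. Qed.

Lemma log_ops_ge m : C * ltmax m + n0 <= lops m.
Proof.
  rewrite log_tmax_eq. unfold log_ops, padding. pose proof (blocks_le m).
  rewrite Nat.mul_add_distr_l. lia.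
Qed.

Lemma log_tmax_le m : ltmax m <= lops m.
Proof.
  eapply Nat.le_trans; [|apply log_ops_ge].
  assert (ltmax m <= C * ltmax m) by now apply le_mul_pos. lia.
Qed.

Lemma q_blocks_le m : q * a m <= m.
Proof. pose proof (blocks_le m). lia. Qed.

Lemma le_pow2_linear x m : x <= 2 ^ (x * S m).
Proof.
  apply Nat.lt_le_incl. eapply Nat.lt_le_trans; [apply (Nat.pow_gt_lin_r 2); lia|].
  apply Nat.pow_le_mono_r; [easy|]. nia.
Qed.

Lemma pow2_linear_mono x y m : x <= y -> 2 ^ (x * S m) <= 2 ^ (y * S m).
Proof. intros H. apply Nat.pow_le_mono_r; [easy|]. now apply Nat.mul_le_mono_r. Qed.

(** All quantities are at most exponential in [m], so words of [O(m)] bits suffice both for the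
    program and for the larger of its tenants, the simulated data structure with its own word
    length. *)
Lemma capacity : exists b', forall m phi, is_kcnf k m phi ->
  2 ^ lops m + lops m + 2 * m + length (encode_cnf m phi)
    + constants_bound k q carry_bits select_bits shrink padding tau < 2 ^ (b' * S m)
  /\ 2 ^ (b * S (lops m)) <= 2 ^ (b' * S m).
Proof.
  set (cb := constants_bound k q carry_bits select_bits shrink padding tau).
  set (e0 := k + 1 + padding + 2 + select_bits).
  set (x := e0 + 2 + (2 * k + (2 + S k)) + cb).
  assert (Hlog : forall m, lops m <= e0 * S m).
  { intros m. unfold log_ops, e0. pose proof (q_blocks_le m).
    assert (a m <= m) by (apply div_le).
    assert (k * a m <= k * m) by now apply Nat.mul_le_mono_l. lia. }
  exists (x + 3 + b * (e0 + 1)). intros m phi Hphi. split.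
  - apply Nat.lt_le_trans with (2 ^ ((x + 3) * S m)).
    2:{ apply pow2_linear_mono. lia. }
    assert (H1 : 2 ^ lops m <= 2 ^ (x * S m)).
    { apply Nat.pow_le_mono_r; [easy|]. eapply Nat.le_trans; [apply Hlog|].
      apply Nat.mul_le_mono_r. unfold x. lia. }
    assert (H2 : lops m < 2 ^ lops m) by (apply Nat.pow_gt_lin_r; lia).
    assert (Hm : 2 * m + 1 <= 2 ^ (2 * S m)).
    { assert (2 * S m < 2 ^ (2 * S m)) by (apply Nat.pow_gt_lin_r; lia). lia. }
    assert (H3 : 2 * m <= 2 ^ (x * S m)).
    { assert (2 ^ (2 * S m) <= 2 ^ (x * S m)) by (apply pow2_linear_mono; unfold x; lia). lia. }
    assert (H4 : length (encode_cnf m phi) <= 2 ^ (x * S m)).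
    { eapply Nat.le_trans; [apply (length_encode_cnf k), Hphi|].
      assert (Hpow : (2 * m + 1) ^ k <= 2 ^ (2 * k * S m)).
      { eapply Nat.le_trans; [apply Nat.pow_le_mono_l, Hm|].
        rewrite <- Nat.pow_mul_r. apply Nat.pow_le_mono_r; lia. }
      assert ((2 * m + 1) ^ k <> 0) by (apply Nat.pow_nonzero; lia).
      apply Nat.le_trans with ((2 * m + 1) ^ k * (2 + S k)); [nia|].
      eapply Nat.le_trans; [apply Nat.mul_le_mono; [exact Hpow|apply (le_pow2_linear _ m)]|].
      rewrite <- Nat.pow_add_r, <- Nat.mul_add_distr_r. apply pow2_linear_mono. unfold x. lia. }
    assert (H5 : cb <= 2 ^ (x * S m)).
    { eapply Nat.le_trans; [apply (le_pow2_linear _ m)|]. apply pow2_linear_mono. unfold x. lia. }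
    (* The five summands are at most [X] each, so three additional bits give room for their sum. *)
    rewrite Nat.mul_add_distr_r, Nat.pow_add_r.
    assert (2 ^ (3 * 1) <= 2 ^ (3 * S m)) by (apply Nat.pow_le_mono_r; lia).
    change (2 ^ (3 * 1)) with 8 in *.
    set (X := 2 ^ (x * S m)) in *. set (Y := 2 ^ (3 * S m)) in *.
    assert (8 * X <= X * Y) by (rewrite Nat.mul_comm; now apply Nat.mul_le_mono_l). lia.
  - apply Nat.pow_le_mono_r; [easy|].
    apply Nat.le_trans with (b * (e0 + 1) * S m).
    + rewrite <- Nat.mul_assoc. apply Nat.mul_le_mono_l. specialize (Hlog m). lia.
    + apply Nat.mul_le_mono_r. lia.
Qed.

(** Since [2 m + 1 <= 2 * shrink * (a + 1)], the number of clauses is [O((a + 1) ^ k)], hence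
    [O(2 ^ a)]. *)
Lemma step_time_le : exists W, forall m phi, is_kcnf k m phi ->
  step_time k q select_bits phi <= W * 2 ^ a m.
Proof.
  set (c1 := time (decode k q) + S (cost (var 16)) + time (choose_op k q select_bits)
             + time collect + 10).
  exists ((2 * shrink) ^ k * k ^ k * clause_time k q + c1). intros m phi Hphi.
  unfold step_time.
  assert (Hlen : length phi <= (2 * shrink) ^ k * k ^ k * 2 ^ a m).
  { eapply Nat.le_trans; [apply length_kcnf, Hphi|].
    rewrite <- Nat.mul_assoc.
    eapply Nat.le_trans; [|apply Nat.mul_le_mono_l, pow_le_exponential, hk].
    rewrite <- Nat.pow_mul_l. apply Nat.pow_le_mono_l.
    assert (Hs : shrink <> 0) by (unfold shrink; nia).
    pose proof (Nat.div_mod_eq m shrink). pose proof (Nat.mod_upper_bound m shrink Hs).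
    change (m / shrink) with (a m) in *. nia. }
  assert (2 ^ a m <> 0) by now apply Nat.pow_nonzero.
  assert (length phi * clause_time k q <= (2 * shrink) ^ k * k ^ k * 2 ^ a m * clause_time k q)
    by now apply Nat.mul_le_mono_r.
  assert (c1 <= c1 * 2 ^ a m) by apply le_mul_pow2.
  unfold c1 in *. nia.
Qed.

End Constants.

(** * Real exponents and the final estimate *)

Lemma Rpower_2_INR n : Rpower 2 (INR n) = INR (2 ^ n).
Proof. rewrite Rpower_pow by lra. now rewrite pow_INR. Qed.

Lemma INR_unbounded_above (x : R) : exists n : nat, (x <= INR n)%R.
Proof.
  destruct (Rle_or_lt x 0) as [H|H]; [exists 0; simpl; lra|].
  destruct (archimed x) as [H1 _]. exists (Z.to_nat (up x)).
  rewrite INR_IZR_INZ, Z2Nat.id; [lra|]. apply le_IZR. lra.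
Qed.

Lemma Rpower_2_le x y : (x <= y)%R -> (Rpower 2 x <= Rpower 2 y)%R.
Proof. intros. apply Rle_Rpower; lra. Qed.

(** Only powers of two are used as [tmax]. Rounding [c] up to [C] and the length constant up to
    [2 ^ n0] demands longer sequences; capping [eps] at 1 and raising [K] to at least 0 weakens the
    time bound. *)
Lemma amortized_time_bound_normalize b p c eps :
  (0 < c)%R -> (0 < eps)%R -> amortized_time_bound b p c eps ->
  exists (C n0 t0 : nat) (eps' K : R), 1 <= C /\ 0 < t0 /\ (0 < eps' <= 1)%R /\ (0 <= K)%R /\
    forall l (ops : list operation) (T : nat),
      t0 <= 2 ^ l -> valid (2 ^ l) [] ops -> 2 ^ (C * l + n0) <= length ops ->
      processes b p (2 ^ l) ops T ->
      (INR T <= K * Rpower 2 (INR l * (1 - eps')) * INR (length ops))%R.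
Proof.
  intros Hc Heps (a0 & K & t0 & Ha0 & Ht0 & H).
  destruct (INR_unbounded_above (Rmax c 1)) as [C HC].
  destruct (INR_unbounded_above a0) as [n0 Hn0].
  exists C, n0, t0, (Rmin eps 1), (Rmax K 0).
  assert (H1 : (1 <= INR C)%R) by (eapply Rle_trans; [apply Rmax_r|exact HC]).
  split; [apply INR_le; simpl; lra|]. split; [easy|].
  split; [split; [apply Rmin_pos; lra|apply Rmin_r]|]. split; [apply Rmax_r|].
  intros l ops T Hl Hvalid Hlen Hproc.
  assert (Hl0 : (0 <= INR l)%R) by apply pos_INR.
  assert (Hpow : forall x, Rpower (INR (2 ^ l)) x = Rpower 2 (INR l * x)).
  { intros x. rewrite <- Rpower_2_INR. apply Rpower_mult. }
  assert (Hlen' : (a0 * Rpower (INR (2 ^ l)) c <= INR (length ops))%R).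
  { apply le_INR in Hlen. eapply Rle_trans; [|exact Hlen].
    rewrite <- (Rpower_2_INR (C * l + n0)), plus_INR, mult_INR, Rpower_plus, Rmult_comm, Hpow.
    apply Rmult_le_compat; [apply Rlt_le, exp_pos|lra| |].
    - apply Rpower_2_le. rewrite (Rmult_comm (INR C)). apply Rmult_le_compat_l; [easy|].
      eapply Rle_trans; [apply Rmax_l|exact HC].
    - eapply Rle_trans; [exact Hn0|]. rewrite Rpower_2_INR. apply le_INR.
      apply Nat.lt_le_incl, Nat.pow_gt_lin_r. lia. }
  specialize (H (2 ^ l) ops T Hl Hvalid Hlen' Hproc).
  assert (Hpos : (0 < INR (length ops))%R).
  { apply lt_0_INR. assert (2 ^ (C * l + n0) <> 0) by now apply Nat.pow_nonzero. lia. }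
  apply (Rmult_le_compat_r (INR (length ops))) in H; [|lra].
  unfold Rdiv in H. rewrite Rmult_assoc, Rinv_l, Rmult_1_r in H by lra.
  eapply Rle_trans; [exact H|]. apply Rmult_le_compat_r; [lra|].
  rewrite Hpow. assert (Hexp : (0 < Rpower 2 (INR l * (1 - eps)))%R) by apply exp_pos.
  apply Rle_trans with (Rmax K 0 * Rpower 2 (INR l * (1 - eps)))%R.
  - apply Rmult_le_compat_r; [lra|apply Rmax_l].
  - apply Rmult_le_compat_l; [apply Rmax_r|]. apply Rpower_2_le.
    apply Rmult_le_compat_l; [easy|]. pose proof (Rmin_l eps 1). lra.
Qed.

(* [D = 3 C q] and [e q >= 2 (k + 2)] make the savings at least [e q / 2] bits
   per block length [a >= m / D - 1]. *)
Lemma exponent_bound (m a k q C e X E Y : R) :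
  (0 <= a -> 1 <= C -> 0 < q -> 0 < e <= 1 -> 2 * (k + 2) <= e * q -> 0 <= E ->
   m <= 3 * C * q * (a + 1) ->
   X <= m - q * a + k * a + Y ->
   X + ((q + 2) * a + E) * (1 - e) <= (1 - e / (6 * C)) * m + (Y + E + e * q / 2) /\
   X + a <= (1 - e / (6 * C)) * m + (Y + E + e * q / 2))%R.
Proof.
  intros Ha HC Hq He Hkq HE Hm HX.
  assert (Hsave : (e / (6 * C) * m <= e * q / 2 * (a + 1))%R).
  { apply Rle_trans with (e / (6 * C) * (3 * C * q * (a + 1)))%R.
    - apply Rmult_le_compat_l; [|easy]. apply Rlt_le, Rdiv_lt_0_compat; lra.
    - right. field. lra. }
  assert (H1 : (a * (2 * (k + 2)) <= a * (e * q))%R) by now apply Rmult_le_compat_l.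
  assert (H2 : (a * q * e <= a * q * 1)%R).
  { apply Rmult_le_compat_l; [|lra]. apply Rmult_le_pos; lra. }
  assert (H3 : (0 <= E * e)%R) by (apply Rmult_le_pos; lra).
  assert (H4 : (0 <= a * e)%R) by (apply Rmult_le_pos; lra).
  (* The first exponent is that of the data structure, the second that of the clause tests. By [H1]
     the overhead uses up at most half of the saving; in the second case [H2] shows that [q a] saves
     at least [e q a]. *)
  split; nra.
Qed.

Theorem theorem3 (c eps : R) (hc : (0 < c)%R) (heps : (0 < eps)%R) :
  SETH ->
  ~ exists (b : nat) (p : cmd),
      solves_dynamic_subset_sum b p /\ amortized_time_bound b p c eps.
Proof.
  intros Hseth (b & p & Hsolves & Hamortized).
  destruct (amortized_time_bound_normalize b p c eps hc heps Hamortized)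
    as (C & n0 & t0 & e & K & HC & Ht0 & He & HK & Hbound).
  assert (HCr : (1 <= INR C)%R) by (apply (le_INR 1); exact HC).
  (* This is the saving [e q a / 2] with [q a] replaced by [m / (3 C)]. *)
  set (delta := (e / (6 * INR C))%R).
  assert (Hdelta : (0 < delta)%R) by (apply Rdiv_lt_0_compat; lra).
  destruct (Hseth delta Hdelta) as (k & Hk3 & Hunsolvable).
  apply Hunsolvable. clear Hunsolvable.
  assert (hk : 1 <= k) by lia.
  destruct (INR_unbounded_above (2 * (INR k + 2) / e)) as [q Hq].
  assert (Hkq : (2 * (INR k + 2) <= e * INR q)%R).
  { apply (Rmult_le_compat_l e) in Hq; [|lra].
    replace (e * (2 * (INR k + 2) / e))%R with (2 * (INR k + 2))%R in Hq by (field; lra). easy. }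
  assert (Hk0 : (0 <= INR k)%R) by apply pos_INR.
  assert (hq : 2 <= q).
  { apply INR_le. simpl INR. assert (0 <= INR q)%R by apply pos_INR. nra. }
  assert (Hqr : (2 <= INR q)%R) by (apply (le_INR 2) in hq; exact hq).
  set (gam := select_bits k q). set (r0 := carry_bits k q).
  set (D := shrink q C). set (extra := padding k q C n0 t0).
  set (E := tmax_const k q t0).
  destruct (capacity k q C n0 t0 b hk hq HC) as [b' Hcap].
  destruct (step_time_le k q C hk hq HC) as [W HW].
  set (prog := sat_program k q r0 gam D extra t0 p).
  set (c0 := time (init k q r0 gam D extra t0) + 11).
  set (Y := INR (extra + 2 + gam)).
  exists prog, b', ((INR c0 + K + INR W) * Rpower 2 (Y + INR E + e * INR q / 2))%R.
  intros m phi Hphi.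
  destruct (Hcap m phi Hphi) as [HB HBp].
  pose proof (log_ops_ge k q C n0 t0 hk hq HC m) as Hops.
  pose proof (log_tmax_le k q C n0 t0 hk hq HC m) as Hlog.
  pose proof (log_tmax_eq k q C t0 m) as Htmax.
  pose proof (q_blocks_le k q C hk hq HC m) as Hqa.
  specialize (HW m phi Hphi).
  fold gam r0 D extra E in HB, HBp, Hops, Hlog, Hqa, HW, Htmax.
  set (a := block_size D m) in *.
  set (lt := log_tmax k q r0 gam D t0 m) in *.
  set (lo := log_ops k q gam D extra m) in *.
  assert (hgam : groups k q < 2 ^ gam) by (apply Nat.pow_gt_lin_r; lia).
  assert (hr0 : groups k q * degree k q < 2 ^ r0) by (apply Nat.pow_gt_lin_r; lia).
  assert (hq1 : 1 <= q) by lia.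
  set (ops := op_sequence k q a r0 gam phi (prefix_bits q D extra m)).
  assert (Hlen : length ops = 2 ^ lo).
  { unfold ops, a. now rewrite op_sequence_eq, length_map, length_seq. }
  assert (Hwl : word_length (2 ^ lt) ops = S lo) by (eapply word_length_ops; eauto).
  assert (Hvalid : valid (2 ^ lt) [] ops).
  { eapply op_sequence_correct; eauto; [|unfold prefix_bits; fold a; lia].
    eapply Nat.lt_le_incl, target_lt; eauto. }
  destruct (Hsolves (2 ^ lt) ops Hvalid) as [T HT].
  assert (HTbound := Hbound lt ops T).
  unfold processes in HT, HTbound. rewrite Hwl in HT, HTbound.
  assert (HINR : (INR T <= K * Rpower 2 (INR lt * (1 - e)) * INR (length ops))%R).
  { apply HTbound; [|exact Hvalid|rewrite Hlen; apply Nat.pow_le_mono_r; lia|exact HT].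
    (* [t0] was passed as [tau], so already [log_tmax] is at least [t0]. *)
    apply Nat.le_trans with lt; [rewrite Htmax; unfold E, tmax_const; lia|].
    apply Nat.lt_le_incl, Nat.pow_gt_lin_r. lia. }
  destruct (sat_program_runs k q r0 gam D extra t0 p m phi _ hk hq1 hgam hr0 Hphi Hqa Hlog HB
              _ HBp T HT) as (T' & s & Hexec & HT' & Hcorrect).
  exists T', s. split; [exact Hexec|]. split; [exact Hcorrect|].
  fold lo in HT'.
  assert (HT2 : T' <= c0 + T + W * 2 ^ (lo + a)).
  { eapply Nat.le_trans; [exact HT'|]. unfold c0. rewrite Nat.pow_add_r.
    apply (Nat.mul_le_mono_l _ _ (2 ^ lo)) in HW. lia. }
  apply le_INR in HT2. rewrite !plus_INR, mult_INR, <- Rpower_2_INR, plus_INR in HT2.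
  rewrite Hlen, <- Rpower_2_INR, Rmult_assoc, <- Rpower_plus in HINR.
  assert (Hm : (INR m <= 3 * INR C * INR q * (INR a + 1))%R).
  { assert (HD : D <> 0) by (pose proof (shrink_ge q C hq HC); unfold D; lia).
    assert (Hmn : m <= 3 * C * q * (a + 1)).
    { pose proof (Nat.div_mod_eq m D). pose proof (Nat.mod_upper_bound m D HD).
      change (m / D) with a in *. change (3 * C * q) with D. lia. }
    apply le_INR in Hmn. rewrite !mult_INR, plus_INR in Hmn. simpl in Hmn.
    replace (3 * INR C)%R with ((1 + 1 + 1) * INR C)%R by ring. exact Hmn. }
  assert (HX : (INR lo <= INR m - INR q * INR a + INR k * INR a + Y)%R).
  { unfold lo, log_ops, Y. fold a.
    rewrite !plus_INR, minus_INR, !mult_INR by exact Hqa. lra. }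
  assert (Hltr : INR lt = ((INR q + 2) * INR a + INR E)%R).
  { rewrite Htmax, plus_INR, mult_INR, plus_INR. simpl. ring. }
  destruct (exponent_bound (INR m) (INR a) (INR k) (INR q) (INR C) e (INR lo) (INR E) Y)
    as [H1 H2]; auto using pos_INR; [lra|].
  rewrite <- Hltr in H1. fold delta in H1, H2.
  rewrite (Rplus_comm (INR lt * _)) in HINR.
  rewrite Rmult_assoc, <- Rpower_plus, (Rplus_comm _ ((1 - delta) * INR m)).
  set (Z := ((1 - delta) * INR m + (Y + INR E + e * INR q / 2))%R) in *.
  (* Non-negativity of [Z] allows the additive constant [c0] to be absorbed into [Rpower 2 Z]. *)
  assert (HZ : (0 <= Z)%R).
  { assert (delta <= 1)%R.
    { unfold delta. apply (Rmult_le_reg_r (6 * INR C)); [lra|].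
      unfold Rdiv. rewrite Rmult_assoc, Rinv_l; lra. }
    assert (0 <= (1 - delta) * INR m)%R by (apply Rmult_le_pos; [lra|apply pos_INR]).
    assert (0 <= Y)%R by apply pos_INR. assert (0 <= INR E)%R by apply pos_INR.
    assert (0 <= e * INR q)%R by (apply Rmult_le_pos; lra). unfold Z. lra. }
  apply Rpower_2_le in H1, H2, HZ. rewrite Rpower_O in HZ by lra.
  assert (G0 : (INR c0 * 1 <= INR c0 * Rpower 2 Z)%R)
    by (apply Rmult_le_compat_l; [apply pos_INR|exact HZ]).
  assert (G1 := Rmult_le_compat_l K _ _ HK H1).
  assert (G2 := Rmult_le_compat_l (INR W) _ _ (pos_INR W) H2).
  lra.
Qed.
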